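(* Let $\lambda>0$ and $\omega\in[0,1)$. If $LR(\alpha)$ holds for the Fibonacci XY chain with coupling $\lambda$ and phase $\omega$, then $\alpha\ge\alpha_u^+(\lambda)$.
   Context: Fix $\lambda>0$, $\omega\in[0,1)$, and let $\phi=\frac{1+\sqrt5}{2}$. The Fibonacci field is $V_j=\lambda\,\chi_{[1-\phi^{-1},1)}(j\phi^{-1}+\omega \bmod 1)$, $j\ge1$. For $n\ge1$ let $\mathcal H_n=\bigotimes_{j=1}^n\mathbb C^2$ and $$H_n^{XY}=-\sum_{j=1}^{n-1}(\sigma^x_j\sigma^x_{j+1}+\sigma^y_j\sigma^y_{j+1})+\sum_{j=1}^n V_j\sigma^z_j,$$ where $\sigma^{x,y,z}$ are the Pauli matrices and $\sigma^{x,y,z}_j$ acts as that matrix on the $j$-th factor and as the identity elsewhere. For $J\subset\{1,\dots,n\}$, $\mathcal A_J=\bigotimes_{j\in J}\mathcal B(\mathbb C^2)$, embedded in $\mathcal B(\mathcal H_n)$ by tensoring with identities; $\mathcal A_j=\mathcal A_{\{j\}}$. The Heisenberg dynamics is $\tau_t^n(A)=e^{itH_n^{XY}}Ae^{-itH_n^{XY}}$. ''$LR(\alpha)$ holds'' means: there exist constants $C_0,\mu>0$, $v\ge0$ such that for all $n$, all $1\le j<j'\le n$, all $t>0$, all $A\in\mathcal A_j$, $B\in\mathcal A_{\{j',\dots,n\}}$: $\|[\tau_t^n(A),B]\|\le C_0\|A\|\|B\|e^{-\mu(|j'-j|-vt^\alpha)}$. The half-line Fibonacci Hamiltonian $H=H(\omega)$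 on $\ell^2(\mathbb Z_+)$ (basis $\{\delta_l\}_{l\ge1}$) is $(Hu)(m)=u(m+1)+u(m-1)+V_m u(m)$ with $u(0)=0$. Define $P(N,t)=\sum_{m>N}|\langle\delta_1,e^{-itH}\delta_m\rangle|^2$, $S^+(\alpha)=-\limsup_{t\to\infty}\frac{\log P(t^\alpha-1,t)}{\log t}$, and $\alpha_u^+(\lambda)=\sup\{\alpha\ge0:S^+(\alpha)<\infty\}$ (computed for $H(\omega)$). *)

(* Defs.v *)
From Stdlib Require Import Reals Lra Lia Arith ClassicalEpsilon.
Open Scope R_scope.

Record Cx := mkC { Cre : R ; Cim : R }.
Definition C0 : Cx := mkC 0 0.
Definition C1 : Cx := mkC 1 0.
Definition Ci : Cx := mkC 0 1.
Definition Cadd (z w : Cx) : Cx := mkC (Cre z + Cre w) (Cim z + Cim w).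
Definition Copp (z : Cx) : Cx := mkC (- Cre z) (- Cim z).
Definition Csub (z w : Cx) : Cx := Cadd z (Copp w).
Definition Cmul (z w : Cx) : Cx :=
  mkC (Cre z * Cre w - Cim z * Cim w) (Cre z * Cim w + Cim z * Cre w).
Definition Cscale (r : R) (z : Cx) : Cx := mkC (r * Cre z) (r * Cim z).
Definition Cnorm2 (z : Cx) : R := Cre z * Cre z + Cim z * Cim z.

Fixpoint Csum (n : nat) (f : nat -> Cx) : Cx :=
  match n with O => C0 | S m => Cadd (Csum m f) (f m) end.
Fixpoint Rsum (n : nat) (f : nat -> R) : R :=
  match n with O => 0 | S m => Rsum m f + f m end.

Definition Ccv (u : nat -> Cx) (z : Cx) : Prop :=
  Un_cv (fun N => Cre (u N)) (Cre z) /\ Un_cv (fun N => Cim (u N)) (Cim z).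
Definition Clim (u : nat -> Cx) : Cx := epsilon (inhabits C0) (Ccv u).

(** * Matrices on C^D, basis indexed by 0..D-1 (entries outside are ignored) *)
Definition mat := nat -> nat -> Cx.
Definition vec := nat -> Cx.
Definition matmul (D : nat) (A B : mat) : mat :=
  fun a b => Csum D (fun k => Cmul (A a k) (B k b)).
Definition matadd (A B : mat) : mat := fun a b => Cadd (A a b) (B a b).
Definition matsub (A B : mat) : mat := fun a b => Csub (A a b) (B a b).
Definition matscale (z : Cx) (A : mat) : mat := fun a b => Cmul z (A a b).
Definition matid : mat := fun a b => if Nat.eqb a b then C1 else C0.
Fixpoint matpow (D : nat) (A : mat) (k : nat) : mat :=
  match k with O => matid | S m => matmul D (matpow D A m) A end.
Definition commutator (D : nat) (A B : mat) : mat :=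
  matsub (matmul D A B) (matmul D B A).

Definition expm (D : nat) (M : mat) : mat :=
  fun a b => Clim (fun N => Csum N (fun k => Cscale (/ INR (fact k)) (matpow D M k a b))).

Definition matvec (D : nat) (A : mat) (v : vec) : vec :=
  fun a => Csum D (fun k => Cmul (A a k) (v k)).
Definition vnorm (D : nat) (v : vec) : R := sqrt (Rsum D (fun k => Cnorm2 (v k))).

Definition opnorm (D : nat) (M : mat) : R :=
  epsilon (inhabits 0) (is_lub (fun r => exists v : vec,
             vnorm D v <= 1 /\ r = vnorm D (matvec D M v))).

(** * Tensor structure of (C^2)^{⊗n}: basis state a < 2^n, bit (j-1) of a is
    the spin at site j.  [embed p q B] is B ⊗ identity, where B acts on the
    sites p..q (a 2^(q-p+1)-dimensional matrix). *)
Definition embed (p q : nat) (B : mat) : mat :=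
  fun a b =>
    if andb (Nat.eqb (a mod 2 ^ (p - 1)) (b mod 2 ^ (p - 1)))
            (Nat.eqb (a / 2 ^ q) (b / 2 ^ q))
    then B ((a / 2 ^ (p - 1)) mod 2 ^ (q - p + 1))
           ((b / 2 ^ (p - 1)) mod 2 ^ (q - p + 1))
    else C0.

Definition sx : mat := fun a b =>
  match a, b with 0%nat, 1%nat => C1 | 1%nat, 0%nat => C1 | _, _ => C0 end.
Definition sy : mat := fun a b =>
  match a, b with 0%nat, 1%nat => Copp Ci | 1%nat, 0%nat => Ci | _, _ => C0 end.
Definition sz : mat := fun a b =>
  match a, b with 0%nat, 0%nat => C1 | 1%nat, 1%nat => Copp C1 | _, _ => C0 end.

Definition phi : R := (1 + sqrt 5) / 2.
Definition frac (x : R) : R := x - IZR (Int_part x).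
Definition Vfib (lam om : R) (j : nat) : R :=
  let x := frac (INR j * / phi + om) in
  if Rle_dec (1 - / phi) x then (if Rlt_dec x 1 then lam else 0) else 0.

Definition Hxy (lam om : R) (n : nat) : mat :=
  let D := (2 ^ n)%nat in
  fun a b =>
    Cadd
      (Csum (n - 1) (fun k => let j := S k in
         Copp (Cadd (matmul D (embed j j sx) (embed (S j) (S j) sx) a b)
                    (matmul D (embed j j sy) (embed (S j) (S j) sy) a b))))
      (Csum n (fun k => let j := S k in Cscale (Vfib lam om j) (embed j j sz a b))).

Definition tau (lam om : R) (n : nat) (t : R) (A : mat) : mat :=
  let D := (2 ^ n)%nat in
  matmul D (matmul D (expm D (matscale (mkC 0 t) (Hxy lam om n))) A)
           (expm D (matscale (mkC 0 (- t)) (Hxy lam om n))).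

Definition LR (lam om alpha : R) : Prop :=
  exists C0' mu v : R, 0 < C0' /\ 0 < mu /\ 0 <= v /\
    forall (n j j' : nat) (t : R) (A B : mat),
      (1 <= j)%nat -> (j < j')%nat -> (j' <= n)%nat -> 0 < t ->
      opnorm (2 ^ n) (commutator (2 ^ n) (tau lam om n t (embed j j A))
                                         (embed j' n B))
      <= C0' * opnorm 2 A * opnorm (2 ^ (n - j' + 1)) B
           * exp (- mu * (INR (j' - j) - v * Rpower t alpha)).

(** * Half-line Fibonacci operator.  [hvec k m] = <delta_m, H^k delta_1>
    = <delta_1, H^k delta_m> (H real symmetric), with u(0) = 0. *)
Fixpoint hvec (lam om : R) (k : nat) (m : nat) : R :=
  match k with
  | O => if Nat.eqb m 1 then 1 else 0
  | S k' => match m with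
            | O => 0
            | S m' => hvec lam om k' (S m) + hvec lam om k' m'
                      + Vfib lam om m * hvec lam om k' m
            end
  end.

Fixpoint Cpow (z : Cx) (k : nat) : Cx :=
  match k with O => C1 | S k' => Cmul (Cpow z k') z end.

(** <delta_1, e^{-itH} delta_m> = sum_k (-it)^k/k! <delta_1, H^k delta_m> *)
Definition amp (lam om t : R) (m : nat) : Cx :=
  Clim (fun N => Csum N (fun k =>
     Cscale (t ^ k / INR (fact k) * hvec lam om k m) (Cpow (Copp Ci) k))).

Definition Pout (lam om N t : R) : R :=
  epsilon (inhabits 0) (infinite_sum (fun m =>
     if Nat.eqb m 0 then 0
     else if Rlt_dec N (INR m) then Cnorm2 (amp lam om t m) else 0)).

(** S^+(beta) < infinity, i.e. limsup_{t->oo} log P(t^beta - 1, t)/log t > -oo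
    (with log 0 = -oo). *)
Definition Splus_finite (lam om beta : R) : Prop :=
  exists K : R, forall T : R, exists t : R,
    T < t /\ 1 < t /\
    0 < Pout lam om (Rpower t beta - 1) t /\
    - K <= ln (Pout lam om (Rpower t beta - 1) t) / ln t.

(* Main.v *)
(** In the sector with one flipped spin, [H^XY] acts as [E_0 - 2 H_n], where [H_n] is
    the Fibonacci Hamiltonian truncated to [n] sites.  The vacuum matrix element of
    the commutator of the evolved annihilator at [j] with the creator at [m] is, up to
    a phase, the propagator of [H_n] between [j] and [m] at time [2t], so [LR(alpha)]
    bounds that propagator by [C exp(-mu (m - j - v t^alpha))] uniformly in [n].

    For [beta > 0], letting [n] tend to infinity bounds [P(t^beta - 1, t)] by a constant
    times [exp(c t^alpha - mu t^beta)].  If [beta > alpha] this decays faster than every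
    power of [t], against [S^+(beta) < oo].

    For [beta = 0] the condition [S^+(0) < oo] carries no information, and [alpha < 0] has
    to be excluded directly.  It would make the propagators of all [H_n] decay exponentially
    in [m - j] uniformly in [t >= 1].  Averaging over time in an eigenbasis of [H_n], this
    localizes the eigenfunctions near each site [j] on average, uniformly in [n] and [j].
    But the Fibonacci potential contains cubes of arbitrarily long blocks, and Gordon's
    argument shows that no eigenfunction is small at distances [q], [2q] from the middle of
    a cube of period [q] relative to its size there. *)

From Stdlib Require Import Reals Lra Lia Arith ZArith ClassicalEpsilon.
From mathcomp Require all_boot all_order all_algebra complex ring Rstruct.
Require Import Defs.
Open Scope R_scope.

(** Sites are [1..n], and the values at [0] and [n + 1] encode Dirichlet conditions, so the
    recurrence has no special case at the ends. Simplicity of the spectrum is recorded because a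
    time average separates only distinct energies. *)
Record eigenbasis (V : nat -> R) (n : nat) (E : nat -> R) (psi : nat -> nat -> R)
  : Prop := {
  eb_bdry : forall k, (k < n)%nat -> psi k 0%nat = 0 /\ psi k (S n) = 0;
  eb_rec : forall k m, (k < n)%nat -> (m < n)%nat ->
    psi k (S (S m)) + psi k m + V (S m) * psi k (S m) = E k * psi k (S m);
  eb_norm : forall k, (k < n)%nat ->
    Rsum n (fun i => psi k (S i) * psi k (S i)) = 1;
  eb_complete : forall i j, (i < n)%nat -> (j < n)%nat ->
    Rsum n (fun k => psi k (S i) * psi k (S j)) = if Nat.eqb i j then 1 else 0;
  eb_inj : forall k l, (k < n)%nat -> (l < n)%nat -> E k = E l -> k = l }.

(** * Spectral decomposition of Jacobi matrices *)

Module Jacobi.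
Import all_boot all_order all_algebra complex ring Rstruct.
Import Order.TTheory GRing.Theory Num.Theory.
Local Open Scope ring_scope.
Local Open Scope complex_scope.
Local Open Scope sesquilinear_scope.

Section Spectral.
Context {R : rcfType} (V : nat -> R) (n : nat).

(** The pair [(u(m), u(m+1))] for the real solution at energy [e] with [u(0) = 0] and [u(1) = 1]. *)
Fixpoint sol (e : R) (m : nat) : R * R :=
  if m is m'.+1 then
    let: (u, v) := sol e m' in (v, (e - V m'.+1) * v - u)
  else (0, 1).

Definition jacobi_mx : 'M[R[i]]_n :=
  \matrix_(i, j) ((i == j.+1 :> nat)%:R + (i.+1 == j :> nat)%:R
                  + (V i.+1)%:C * (i == j :> nat)%:R).

Lemma conj_real (x : R) : Num.conj (x%:C : R[i]) = x%:C.
Proof. by apply: conj_Creal; apply/complex_realP; exists x. Qed.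

Let P := spectralmx jacobi_mx.
Let e (k : 'I_n) : R := complex.Re (spectral_diag jacobi_mx 0 k).

(** Extension by zero past the last column, which encodes the boundary condition at site [n + 1]. *)
Definition at0 (F : 'I_n -> R[i]) (m : nat) : R[i] :=
  if insub m is Some i then F i else 0.

Lemma at0_ord F (i : 'I_n) : at0 F i = F i.
Proof. by rewrite /at0 insubT //= => h; congr F; apply: val_inj. Qed.

Lemma at0_out F m : (n <= m)%N -> at0 F m = 0.
Proof. by move=> h; rewrite /at0 insubF // ltnNge h. Qed.

Lemma sum_delta_at0 (F : 'I_n -> R[i]) m :
  \sum_i F i * (i == m :> nat)%:R = at0 F m.
Proof.
case: (ltnP m n) => h.
  rewrite (bigD1 (Ordinal h)) //= eqxx mulr1 big1 => [|i ne].
    by rewrite addr0 -(at0_ord F (Ordinal h)).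
  by rewrite (negbTE (ne : (i : nat) != m)) mulr0.
rewrite at0_out // big1 // => i _.
by rewrite ltn_eqF ?mulr0 // (leq_trans _ h).
Qed.

Lemma jacobi_hermitian : jacobi_mx \is hermsymmx.
Proof.
apply/is_hermitianmxP/matrixP => i j; rewrite expr0 scale1r !mxE.
rewrite !rmorphD rmorphM !rmorph_nat /= conj_real.
rewrite (eq_sym (j : nat)) (eq_sym (j : nat).+1) (eq_sym (j : nat) i).
by case: (eqVneq (i : nat) (j : nat)) => [->|_]; rewrite ?mulr0 [X in X + _ = _]addrC.
Qed.

Lemma diag_e k : spectral_diag jacobi_mx 0 k = (e k)%:C.
Proof.
rewrite RRe_real //.
exact/mxOverP/hermitian_spectral_diag_real/jacobi_hermitian.
Qed.

(** Row [k] of the diagonalizing unitary, moved to the sites [1..n]; it still carries an arbitrary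
    complex phase. *)
Let q (k : 'I_n) (m : nat) : R[i] := if m is m'.+1 then at0 (P k) m' else 0.

Lemma q_rec k m : (m < n)%N ->
  q k m.+2 + q k m + (V m.+1)%:C * q k m.+1 = (e k)%:C * q k m.+1.
Proof.
move=> h; set j := Ordinal h.
have A_eq := orthomx_spectralP (hermitian_normalmx jacobi_hermitian).
have /matrixP/(_ k j) : P *m jacobi_mx = diag_mx (spectral_diag jacobi_mx) *m P.
  by rewrite {1}A_eq mulmxA mulmxA mulmxV ?spectral_unit // mul1mx.
rewrite mul_diag_mx !mxE diag_e => E.
have qj : q k m.+1 = P k j by rewrite -(at0_ord (P k) j).
rewrite qj -E.
under [RHS]eq_bigr => i _ do rewrite mxE !mulrDr.
rewrite !big_split /= sum_delta_at0.
congr (_ + _ + _).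
  rewrite /q; case: (m) => [|m'].
    by rewrite big1 // => i _; rewrite mulr0.
  rewrite -sum_delta_at0; apply: eq_bigr => i _; by rewrite eqSS.
rewrite (bigD1 j) //= eqxx mulr1 mulrC big1 ?addr0 // => i ne.
by rewrite (negbTE (ne : (i : nat) != m)) !mulr0.
Qed.

(** The second-order recurrence and [q k 0 = 0] leave one free constant, so every eigenvector is a
    complex multiple of the real solution. *)
Lemma q_sol k m : (m <= n)%N ->
  q k m = q k 1 * (sol (e k) m).1%:C /\ q k m.+1 = q k 1 * (sol (e k) m).2%:C.
Proof.
elim: m => [_|m IH lt_mn]; first by rewrite /= mulr0 mulr1.
have [IH1 IH2] := IH (ltnW lt_mn).
split; first by rewrite IH2 /=; case: (sol _ _).
have := q_rec k m lt_mn => /eqP; rewrite -addrA -subr_eq0 => /eqP E.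
have {E} -> : q k m.+2 = ((e k) - V m.+1)%:C * q k m.+1 - q k m.
  by rewrite rmorphB mulrBl; apply/eqP; rewrite -subr_eq0 -[0]E; apply/eqP; ring.
rewrite IH1 IH2 /=; case: (sol _ _) => a b /=.
by rewrite !(rmorphB, rmorphM) /=; ring.
Qed.

Lemma P_sol k (i : 'I_n) : P k i = q k 1 * (sol (e k) i).2%:C.
Proof. by have [_ <-] := q_sol k i (ltnW (ltn_ord i)); rewrite /q at0_ord. Qed.

(** Replacing the factor [q k 1] by its modulus removes the phase. By [psi_mul] the products that
    enter orthonormality are unchanged, so the unitarity of [P] carries over to real
    eigenvectors. *)
Let psi (k : 'I_n) (m : nat) : R := complex.Re `|q k 1| * (sol (e k) m).1.

Lemma psi_mul k a b : (psi k a * psi k b)%:C =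
  (q k 1 * (sol (e k) a).1%:C) * Num.conj (q k 1 * (sol (e k) b).1%:C).
Proof.
have nE : (complex.Re `|q k 1|)%:C = `|q k 1| by rewrite RRe_real ?normr_real.
rewrite /psi; move: (q k 1) nE => z nE; rewrite !rmorphM /= nE conj_real.
transitivity (`|z| ^+ 2 * (sol (e k) a).1%:C * (sol (e k) b).1%:C); first by ring.
by rewrite normCK; ring.
Qed.

Lemma sol_shift x m : (sol x m.+1).1 = (sol x m).2.
Proof. by rewrite /=; case: (sol x m). Qed.

Lemma psi_P k (i j : 'I_n) : (psi k i.+1 * psi k j.+1)%:C = P k i * Num.conj (P k j).
Proof. by rewrite psi_mul !P_sol !sol_shift. Qed.

Lemma psi_norm k : \sum_(i < n) psi k i.+1 * psi k i.+1 = 1.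
Proof.
apply: (@complexI R); rewrite rmorph_sum rmorph1 /=.
have /unitarymxP/matrixP/(_ k k) := spectral_unitarymx jacobi_mx.
rewrite !mxE eqxx mulr1n => <-; apply: eq_bigr => i _.
by rewrite psi_P !mxE.
Qed.

Lemma psi_complete (i j : 'I_n) :
  \sum_k psi k i.+1 * psi k j.+1 = (i == j)%:R.
Proof.
apply: (@complexI R); rewrite rmorph_sum /= rmorph_nat.
have U : P^t* *m P = 1%:M.
  by rewrite -invmx_unitary ?spectral_unitarymx // mulVmx ?spectral_unit.
have /matrixP/(_ j i) := U; rewrite !mxE eq_sym => <-; apply: eq_bigr => k _.
by rewrite psi_P !mxE mulrC.
Qed.

Lemma psi_rec k m : (m < n)%N ->
  psi k m.+2 + psi k m + V m.+1 * psi k m.+1 = e k * psi k m.+1.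
Proof. by move=> h; rewrite /psi /=; case: (sol _ m) => a b /=; ring. Qed.

Lemma q1_neq0 k : q k 1 != 0.
Proof.
apply/eqP => q0; have := psi_norm k; rewrite big1 => [/eqP|i _].
  by rewrite eq_sym oner_eq0.
by rewrite /psi q0 normr0 /= !mul0r.
Qed.

Lemma psi_end k : psi k 0 = 0 /\ psi k n.+1 = 0.
Proof.
rewrite /psi sol_shift /= mulr0; split => //.
have [_] := q_sol k n (leqnn n); rewrite {1}/q at0_out // => /esym/eqP.
by rewrite mulf_eq0 (negbTE (q1_neq0 k)) /= => /eqP [->]; rewrite mulr0.
Qed.

(** Two rows with the same eigenvalue are multiples of the same real solution. Their orthogonality
    then forces the sum of squares of that solution to vanish, against the normalization of row
    [k]. *)
Lemma e_inj k l : e k = e l -> k = l.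
Proof.
move=> ekl; apply/eqP/negPn/negP => ne.
have /unitarymxP/matrixP/(_ k l) := spectral_unitarymx jacobi_mx.
rewrite !mxE (negbTE ne) => /eqP.
under eq_bigr => i _ do
  rewrite !mxE -/P !P_sol -ekl rmorphM /= conj_real mulrACA -rmorphM /=.
rewrite -mulr_sumr mulf_eq0 mulf_eq0 conjC_eq0 !(negbTE (q1_neq0 _)) /=.
move=> /eqP S0; have := psi_norm k.
move=> /(congr1 (@real_complex_def R (Phant R))); rewrite rmorph_sum /=.
under eq_bigr => i _ do
  rewrite psi_P !P_sol rmorphM /= conj_real mulrACA -rmorphM /=.
by rewrite -mulr_sumr S0 mulr0 => /eqP; rewrite eq_sym oner_eq0.
Qed.

Lemma spectral_basis : exists (E : 'I_n -> R) (psi : 'I_n -> nat -> R),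
  [/\ forall k, psi k 0 = 0 /\ psi k n.+1 = 0,
      forall k m, (m < n)%N ->
        psi k m.+2 + psi k m + V m.+1 * psi k m.+1 = E k * psi k m.+1,
      forall k, \sum_(i < n) psi k i.+1 * psi k i.+1 = 1,
      forall i j : 'I_n, \sum_k psi k i.+1 * psi k j.+1 = (i == j)%:R
    & injective E].
Proof.
exists e, psi; split.
- exact: psi_end.
- exact: psi_rec.
- exact: psi_norm.
- exact: psi_complete.
- exact: e_inj.
Qed.

End Spectral.

Lemma Rsum_big n (f : nat -> R) : Rsum n f = \sum_(i < n) f i.
Proof. by elim: n => [|n IH] /=; rewrite ?big_ord0 // big_ord_recr /= IH. Qed.

Lemma exists_eigenbasis (V : nat -> R) (n : nat) :
  exists E psi, eigenbasis V n E psi.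
Proof.
case: (spectral_basis V n) => E [psi [Hb Hr Hn Hc Hi]].
pose E' k := if insub k is Some i then E i else 0.
pose psi' k m := if insub k is Some i then psi i m else 0.
have EE (i : 'I_n) : E' i = E i by rewrite /E' valK.
have PE (i : 'I_n) m : psi' i m = psi i m by rewrite /psi' valK.
exists E', psi'; split.
- by move=> k /ssrnat.ltP lk; rewrite -[k]/(val (Ordinal lk)) !PE; exact: Hb.
- move=> k m /ssrnat.ltP lk /ssrnat.ltP lm; rewrite -[k]/(val (Ordinal lk)) !PE EE.
  exact: Hr.
- move=> k /ssrnat.ltP lk; rewrite Rsum_big -[RHS](Hn (Ordinal lk)).
  by apply: eq_bigr => i _; rewrite -[k]/(val (Ordinal lk)) !PE.
- move=> i j /ssrnat.ltP li /ssrnat.ltP lj; rewrite Rsum_big.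
  have := Hc (Ordinal li) (Ordinal lj).
  under eq_bigr => k _ do rewrite -!PE.
  move=> ->; rewrite -val_eqE /=.
  have -> : Nat.eqb i j = (i == j) by apply/Nat.eqb_spec/eqP.
  by case: (i == j).
- move=> k l /ssrnat.ltP lk /ssrnat.ltP ll; rewrite -[k]/(val (Ordinal lk)).
  by rewrite -[l]/(val (Ordinal ll)) !EE => /Hi ->.
Qed.

End Jacobi.

(** * Propagators as finite sums of exponentials *)

Lemma Cx_ext z w : Cre z = Cre w -> Cim z = Cim w -> z = w.
Proof. destruct z, w; simpl; congruence. Qed.

Lemma Rsum_ext n f g : (forall k, (k < n)%nat -> f k = g k) -> Rsum n f = Rsum n g.
Proof. induction n; simpl; intros H; auto. rewrite IHn, H; auto. Qed.

Lemma Rsum_plus n f g : Rsum n (fun k => f k + g k) = Rsum n f + Rsum n g.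
Proof. induction n; simpl; try rewrite IHn; ring. Qed.

Lemma Rsum_scal n c f : Rsum n (fun k => c * f k) = c * Rsum n f.
Proof. induction n; simpl; try rewrite IHn; ring. Qed.

Lemma Rsum_minus n f g : Rsum n (fun k => f k - g k) = Rsum n f - Rsum n g.
Proof. induction n; simpl; try rewrite IHn; ring. Qed.

Lemma Rsum_zero n f : (forall k, (k < n)%nat -> f k = 0) -> Rsum n f = 0.
Proof. induction n; simpl; intros H; auto. rewrite IHn, H; auto; ring. Qed.

Lemma Rsum_le n f g : (forall k, (k < n)%nat -> f k <= g k) -> Rsum n f <= Rsum n g.
Proof.
  induction n; simpl; intros H; [lra|].
  apply Rplus_le_compat; auto.
Qed.

Lemma Rsum_nonneg n f : (forall k, (k < n)%nat -> 0 <= f k) -> 0 <= Rsum n f.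
Proof. intros H. rewrite <- (Rsum_zero n (fun _ => 0)); auto using Rsum_le. Qed.

Lemma Rsum_swap n m (f : nat -> nat -> R) :
  Rsum n (fun i => Rsum m (fun j => f i j)) = Rsum m (fun j => Rsum n (fun i => f i j)).
Proof.
  induction n; simpl.
  - symmetry; apply Rsum_zero; auto.
  - rewrite IHn, <- Rsum_plus. reflexivity.
Qed.

Lemma Rsum_single n f i :
  (i < n)%nat -> (forall k, (k < n)%nat -> k <> i -> f k = 0) -> Rsum n f = f i.
Proof.
  induction n; simpl; intros Hi H; [lia|].
  destruct (Nat.eq_dec i n) as [->|ne].
  - rewrite Rsum_zero; [ring|]. intros k Hk; apply H; lia.
  - rewrite IHn, (H n); try lia; [ring|]. intros; apply H; lia.
Qed.

Lemma Rsum_term_le n f i :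
  (i < n)%nat -> (forall k, (k < n)%nat -> 0 <= f k) -> f i <= Rsum n f.
Proof.
  induction n; simpl; intros Hi H; [lia|].
  destruct (Nat.eq_dec i n) as [->|ne].
  - assert (0 <= Rsum n f) by (apply Rsum_nonneg; auto). lra.
  - assert (f i <= Rsum n f) by (apply IHn; auto; lia).
    assert (0 <= f n) by auto. lra.
Qed.

Lemma Rsum_mult n m f g :
  Rsum n f * Rsum m g = Rsum n (fun i => Rsum m (fun j => f i * g j)).
Proof.
  rewrite Rmult_comm, <- Rsum_scal.
  apply Rsum_ext; intros. rewrite Rsum_scal; ring.
Qed.

Lemma Cre_Csum n f : Cre (Csum n f) = Rsum n (fun k => Cre (f k)).
Proof. induction n; simpl; try rewrite IHn; reflexivity. Qed.

Lemma Cim_Csum n f : Cim (Csum n f) = Rsum n (fun k => Cim (f k)).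
Proof. induction n; simpl; try rewrite IHn; reflexivity. Qed.

Lemma Csum_ext n f g : (forall k, (k < n)%nat -> f k = g k) -> Csum n f = Csum n g.
Proof. induction n; simpl; intros H; auto. rewrite IHn, H; auto. Qed.

Lemma Csum_zero n f : (forall k, (k < n)%nat -> f k = C0) -> Csum n f = C0.
Proof.
  intros H; apply Cx_ext; rewrite ?Cre_Csum, ?Cim_Csum; apply Rsum_zero;
    intros; rewrite H; auto.
Qed.

Lemma Csum_single n f i :
  (i < n)%nat -> (forall k, (k < n)%nat -> k <> i -> f k = C0) -> Csum n f = f i.
Proof.
  intros Hi H.
  apply Cx_ext; rewrite ?Cre_Csum, ?Cim_Csum.
  - apply (Rsum_single n (fun k => Cre (f k))); auto. intros; rewrite H; auto.
  - apply (Rsum_single n (fun k => Cim (f k))); auto. intros; rewrite H; auto.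
Qed.

Lemma Cmul_0_l z : Cmul C0 z = C0.
Proof. apply Cx_ext; simpl; ring. Qed.

Lemma Cmul_0_r z : Cmul z C0 = C0.
Proof. apply Cx_ext; simpl; ring. Qed.

Lemma Cnorm2_mul z w : Cnorm2 (Cmul z w) = Cnorm2 z * Cnorm2 w.
Proof. unfold Cnorm2; simpl; ring. Qed.

Lemma Cnorm2_nonneg z : 0 <= Cnorm2 z.
Proof. unfold Cnorm2; nra. Qed.

Lemma Clim_eq u z : Ccv u z -> Clim u = z.
Proof.
  intros H. unfold Clim.
  assert (Hs : Ccv u (epsilon (inhabits C0) (Ccv u))) by (apply epsilon_spec; eauto).
  destruct H, Hs. apply Cx_ext; eapply UL_sequence; eauto.
Qed.

Lemma Un_cv_ext u v l : (forall n, u n = v n) -> Un_cv u l -> Un_cv v l.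
Proof.
  intros E H eps He. destruct (H eps He) as [N HN].
  exists N; intros; rewrite <- E; auto.
Qed.

Lemma Un_cv_const c : Un_cv (fun _ => c) c.
Proof.
  intros eps He; exists 0%nat; intros. unfold Rdist.
  replace (c - c) with 0 by ring. rewrite Rabs_R0; auto.
Qed.

Lemma Un_cv_Rsum n (u : nat -> nat -> R) l :
  (forall k, (k < n)%nat -> Un_cv (u k) (l k)) ->
  Un_cv (fun N => Rsum n (fun k => u k N)) (Rsum n l).
Proof.
  induction n; simpl; intros H.
  - apply Un_cv_const.
  - apply (CV_plus (fun N => Rsum n (fun k => u k N)) (u n)); auto.
Qed.

Lemma Cpow_Ci_even i : Cpow Ci (2 * i) = mkC ((-1) ^ i) 0.
Proof.
  induction i; [reflexivity|].
  replace (2 * S i)%nat with (S (S (2 * i))) by lia. cbn [Cpow].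
  rewrite IHi. apply Cx_ext; simpl; ring.
Qed.

Lemma Cpow_Ci_odd i : Cpow Ci (S (2 * i)) = mkC 0 ((-1) ^ i).
Proof. cbn [Cpow]. rewrite Cpow_Ci_even. apply Cx_ext; simpl; ring. Qed.

Lemma Cpow_imag s p : Cpow (mkC 0 s) p = Cscale (s ^ p) (Cpow Ci p).
Proof.
  induction p; simpl; [|rewrite IHp]; apply Cx_ext; simpl; ring.
Qed.

Lemma Rsum_infinite_sum a l : infinite_sum a l -> Un_cv (fun N => Rsum N a) l.
Proof.
  intros H eps He. destruct (H eps He) as [N HN].
  exists (S N); intros n Hn. destruct n as [|n]; [lia|].
  assert (E : forall m, Rsum (S m) a = sum_f_R0 a m).
  { induction m; simpl in *; [ring|rewrite IHm; ring]. }
  rewrite E. apply HN; lia.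
Qed.

Lemma Un_cv_comp u l (f : nat -> nat) :
  (forall M, exists N, forall n, (N <= n)%nat -> (M <= f n)%nat) ->
  Un_cv u l -> Un_cv (fun n => u (f n)) l.
Proof.
  intros Hf H eps He. destruct (H eps He) as [M HM]. destruct (Hf M) as [N HN].
  exists N; intros n Hn; apply HM, HN; lia.
Qed.

(** Odd powers of [i] have no real part, so the first [N] terms of the exponential series contain
    [N / 2], rounded up, terms of the cosine series. *)
Lemma cos_partial x N :
  Rsum N (fun p => x ^ p / INR (fact p) * Cre (Cpow Ci p)) =
  Rsum (Nat.div2 (S N)) (fun i => cos_n i * Rsqr x ^ i).
Proof.
  assert (H : forall M,
    Rsum (2 * M) (fun p => x ^ p / INR (fact p) * Cre (Cpow Ci p)) =
    Rsum M (fun i => cos_n i * Rsqr x ^ i) /\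
    Rsum (S (2 * M)) (fun p => x ^ p / INR (fact p) * Cre (Cpow Ci p)) =
    Rsum (S M) (fun i => cos_n i * Rsqr x ^ i)).
  { assert (S1 : forall M, x ^ (2 * M) / INR (fact (2 * M)) * Cre (Cpow Ci (2 * M))
                 = cos_n M * Rsqr x ^ M).
    { intros M. rewrite Cpow_Ci_even. unfold cos_n; cbn [Cre].
      rewrite pow_mult, <- Rsqr_pow2. field. apply INR_fact_neq_0. }
    induction M as [|M [IH1 IH2]].
    - split; [reflexivity|]. cbn [Rsum]. rewrite <- (S1 0%nat). reflexivity.
    - replace (2 * S M)%nat with (S (S (2 * M))) by lia.
      assert (E : Rsum (S (S (2 * M)))
                (fun p => x ^ p / INR (fact p) * Cre (Cpow Ci p)) =
              Rsum (S M) (fun i => cos_n i * Rsqr x ^ i)).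
      { rewrite <- IH2. cbn [Rsum]. rewrite Cpow_Ci_odd. cbn [Cre]. ring. }
      split; [exact E|]. cbn [Rsum] in E |- *. rewrite E. f_equal.
      replace (S (S (2 * M))) with (2 * S M)%nat by lia. apply S1. }
  destruct (Nat.Even_or_Odd N) as [[M ->]|[M ->]].
  - rewrite Nat.div2_succ_double. apply H.
  - replace (S (2 * M + 1)) with (2 * S M)%nat by lia.
    rewrite Nat.div2_double. replace (2 * M + 1)%nat with (S (2 * M)) by lia. apply H.
Qed.

Lemma sin_partial x N :
  Rsum N (fun p => x ^ p / INR (fact p) * Cim (Cpow Ci p)) =
  x * Rsum (Nat.div2 N) (fun i => sin_n i * Rsqr x ^ i).
Proof.
  assert (H : forall M,
    Rsum (2 * M) (fun p => x ^ p / INR (fact p) * Cim (Cpow Ci p)) =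
    x * Rsum M (fun i => sin_n i * Rsqr x ^ i) /\
    Rsum (S (2 * M)) (fun p => x ^ p / INR (fact p) * Cim (Cpow Ci p)) =
    x * Rsum M (fun i => sin_n i * Rsqr x ^ i)).
  { induction M as [|M [IH1 IH2]].
    - split; simpl; ring.
    - replace (2 * S M)%nat with (S (S (2 * M))) by lia.
      assert (E : Rsum (S (S (2 * M)))
                (fun p => x ^ p / INR (fact p) * Cim (Cpow Ci p)) =
              x * Rsum (S M) (fun i => sin_n i * Rsqr x ^ i)).
      { cbn [Rsum] in IH2 |- *. rewrite IH2, Cpow_Ci_odd. cbn [Cim].
        unfold sin_n. replace (2 * M + 1)%nat with (S (2 * M)) by lia.
        cbn [pow]. rewrite pow_mult, <- Rsqr_pow2. field. apply INR_fact_neq_0. }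
      split; [exact E|]. cbn [Rsum] in E |- *. rewrite E.
      replace (S (S (2 * M))) with (2 * S M)%nat by lia.
      rewrite Cpow_Ci_even. cbn [Cim]. ring. }
  destruct (Nat.Even_or_Odd N) as [[M ->]|[M ->]].
  - rewrite Nat.div2_double. apply H.
  - replace (2 * M + 1)%nat with (S (2 * M)) by lia.
    rewrite Nat.div2_succ_double. apply H.
Qed.

Lemma div2_large M : forall n, (2 * M <= n)%nat -> (M <= Nat.div2 n)%nat.
Proof.
  intros n Hn. rewrite Nat.div2_div. apply Nat.div_le_lower_bound; lia.
Qed.

Lemma exp_imag_series x :
  Ccv (fun N => Csum N (fun p => Cscale (x ^ p / INR (fact p)) (Cpow Ci p)))
      (mkC (cos x) (sin x)).
Proof.
  split; cbn [Cre Cim].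
  - apply Un_cv_ext with (fun N => Rsum (Nat.div2 (S N)) (fun i => cos_n i * Rsqr x ^ i)).
    { intros; rewrite Cre_Csum, <- cos_partial. reflexivity. }
    apply (Un_cv_comp (fun N => Rsum N (fun i => cos_n i * Rsqr x ^ i)) _
             (fun n => Nat.div2 (S n))).
    { intros M; exists (2 * M)%nat; intros; apply div2_large; lia. }
    apply Rsum_infinite_sum. unfold cos. destruct (exist_cos (Rsqr x)); auto.
  - apply Un_cv_ext with (fun N => x * Rsum (Nat.div2 N) (fun i => sin_n i * Rsqr x ^ i)).
    { intros; rewrite Cim_Csum, <- sin_partial. reflexivity. }
    unfold sin. destruct (exist_sin (Rsqr x)) as [l Hl].
    apply (CV_mult (fun _ => x)); [apply Un_cv_const|].
    apply (Un_cv_comp (fun N => Rsum N (fun i => sin_n i * Rsqr x ^ i)) _ Nat.div2).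
    { intros M; exists (2 * M)%nat; intros; apply div2_large; lia. }
    apply Rsum_infinite_sum; exact Hl.
Qed.

(** The matrix element [sum_k e^{i s h_k} w_k] of a unitary group in an eigenbasis. *)
Definition wave (n : nat) (h w : nat -> R) (s : R) : Cx :=
  mkC (Rsum n (fun k => w k * cos (s * h k))) (Rsum n (fun k => w k * sin (s * h k))).

(** Exchanging two finite sums reduces the claim to one scalar exponential per mode. The moments
    [sum_k h_k^p w_k] are matrix elements of [p]-th powers, so this series serves both [expm] on the
    spin chain and the approximation of [amp]. *)
Lemma wave_series n h w s :
  Ccv (fun N => Csum N (fun p =>
         Cscale (s ^ p / INR (fact p) * Rsum n (fun k => h k ^ p * w k)) (Cpow Ci p)))
      (wave n h w s).
Proof.
  assert (G : forall (c : nat -> R) N,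
    Rsum N (fun p => s ^ p / INR (fact p) * Rsum n (fun k => h k ^ p * w k) * c p) =
    Rsum n (fun k => w k * Rsum N (fun p => (s * h k) ^ p / INR (fact p) * c p))).
  { intros c N.
    transitivity (Rsum N (fun p => Rsum n (fun k =>
       w k * ((s * h k) ^ p / INR (fact p) * c p)))).
    - apply Rsum_ext; intros p _. rewrite Rmult_comm, <- Rmult_assoc, <- Rsum_scal.
      apply Rsum_ext; intros. rewrite Rpow_mult_distr. unfold Rdiv; ring.
    - rewrite Rsum_swap. apply Rsum_ext; intros. apply Rsum_scal. }
  split; cbn [Cre Cim wave].
  - apply Un_cv_ext with (fun N => Rsum n (fun k => w k *
       Rsum N (fun p => (s * h k) ^ p / INR (fact p) * Cre (Cpow Ci p)))).
    { intros; rewrite Cre_Csum, <- G. reflexivity. }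
    apply (Un_cv_Rsum n (fun k N => w k * Rsum N (fun p => (s * h k) ^ p / INR (fact p) * Cre (Cpow Ci p)))).
    intros k _. apply (CV_mult (fun _ => w k)); [apply Un_cv_const|].
    destruct (exp_imag_series (s * h k)) as [H _]. revert H; apply Un_cv_ext.
    intros; rewrite Cre_Csum; reflexivity.
  - apply Un_cv_ext with (fun N => Rsum n (fun k => w k *
       Rsum N (fun p => (s * h k) ^ p / INR (fact p) * Cim (Cpow Ci p)))).
    { intros; rewrite Cim_Csum, <- G. reflexivity. }
    apply (Un_cv_Rsum n (fun k N => w k * Rsum N (fun p => (s * h k) ^ p / INR (fact p) * Cim (Cpow Ci p)))).
    intros k _. apply (CV_mult (fun _ => w k)); [apply Un_cv_const|].
    destruct (exp_imag_series (s * h k)) as [_ H]. revert H; apply Un_cv_ext.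
    intros; rewrite Cim_Csum; reflexivity.
Qed.

(** Only energy differences enter the squared modulus, so a common shift and a
    change of sign of the energies are invisible. *)
Lemma wave_norm2 n h w s :
  Cnorm2 (wave n h w s) =
  Rsum n (fun k => Rsum n (fun l => w k * w l * cos (s * (h k - h l)))).
Proof.
  unfold Cnorm2, wave; cbn [Cre Cim]. rewrite !Rsum_mult, <- Rsum_plus.
  apply Rsum_ext; intros k _. rewrite <- Rsum_plus. apply Rsum_ext; intros l _.
  replace (s * (h k - h l)) with (s * h k - s * h l) by ring.
  rewrite cos_minus. ring.
Qed.

(** * The one-particle sector of the XY chain *)

(** The crude factor [2 ^ n] suffices, since the estimate only has to show that the set defining
    [opnorm] is bounded. *)
Lemma Cnorm2_Csum n f : Cnorm2 (Csum n f) <= 2 ^ n * Rsum n (fun k => Cnorm2 (f k)).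
Proof.
  induction n; cbn [Csum Rsum pow].
  - unfold Cnorm2; simpl; lra.
  - assert (H : forall z w, Cnorm2 (Cadd z w) <= 2 * Cnorm2 z + 2 * Cnorm2 w).
    { intros z w. unfold Cnorm2; simpl.
      pose proof (Rle_0_sqr (Cre z - Cre w)). pose proof (Rle_0_sqr (Cim z - Cim w)).
      unfold Rsqr in *. lra. }
    specialize (H (Csum n f) (f n)).
    pose proof (Cnorm2_nonneg (f n)). pose proof (pow_R1_Rle 2 n ltac:(lra)).
    assert (Cnorm2 (f n) <= 2 ^ n * Cnorm2 (f n)) by nra. lra.
Qed.

Lemma vnorm_nonneg D v : 0 <= vnorm D v.
Proof. apply sqrt_pos. Qed.

Lemma vnorm_le_1 D v k : vnorm D v <= 1 -> (k < D)%nat -> Cnorm2 (v k) <= 1.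
Proof.
  intros H Hk.
  assert (Hn : forall i, (i < D)%nat -> 0 <= Cnorm2 (v i)) by (intros; apply Cnorm2_nonneg).
  apply Rle_trans with (Rsum D (fun k => Cnorm2 (v k))).
  - apply (Rsum_term_le D (fun k => Cnorm2 (v k))); auto.
  - rewrite <- (sqrt_sqrt (Rsum D (fun k => Cnorm2 (v k)))) by (apply Rsum_nonneg; auto).
    fold (vnorm D v). pose proof (vnorm_nonneg D v). nra.
Qed.

(** The value chosen by [epsilon] is the supremum once the set is bounded and inhabited; the zero
    vector is a member of the unit ball. *)
Lemma opnorm_is_lub D M :
  is_lub (fun r => exists v : vec, vnorm D v <= 1 /\ r = vnorm D (matvec D M v))
         (opnorm D M).
Proof.
  unfold opnorm. apply epsilon_spec.
  destruct (completeness
    (fun r => exists v : vec, vnorm D v <= 1 /\ r = vnorm D (matvec D M v))) as [l Hl].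
  - exists (sqrt (Rsum D (fun a => 2 ^ D * Rsum D (fun k => Cnorm2 (M a k))))).
    intros r [v [Hv ->]]. apply sqrt_le_1_alt, Rsum_le. intros a _.
    eapply Rle_trans; [apply Cnorm2_Csum|].
    apply Rmult_le_compat_l; [apply pow_le; lra|].
    apply Rsum_le. intros k Hk. rewrite Cnorm2_mul.
    pose proof (vnorm_le_1 _ _ _ Hv Hk). pose proof (Cnorm2_nonneg (M a k)). nra.
  - exists (vnorm D (matvec D M (fun _ => C0))), (fun _ => C0). split; auto.
    unfold vnorm. rewrite Rsum_zero by (intros; unfold Cnorm2; simpl; ring).
    rewrite sqrt_0; lra.
  - exists l; exact Hl.
Qed.

Lemma opnorm_nonneg D M : 0 <= opnorm D M.
Proof.
  apply Rle_trans with (vnorm D (matvec D M (fun _ => C0))); [apply vnorm_nonneg|].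
  apply opnorm_is_lub. exists (fun _ => C0); split; auto.
  unfold vnorm. rewrite Rsum_zero by (intros; unfold Cnorm2; simpl; ring).
  rewrite sqrt_0; lra.
Qed.

Lemma opnorm_entry D M a b :
  (a < D)%nat -> (b < D)%nat -> sqrt (Cnorm2 (M a b)) <= opnorm D M.
Proof.
  intros Ha Hb. set (v := fun k => if Nat.eqb k b then C1 else C0).
  assert (Ev : forall a, matvec D M v a = M a b).
  { intros c. unfold matvec.
    rewrite (Csum_single _ _ b) by
      (auto; intros k _ ne; unfold v; rewrite (proj2 (Nat.eqb_neq k b) ne);
       apply Cmul_0_r).
    unfold v; rewrite Nat.eqb_refl. apply Cx_ext; simpl; ring. }
  apply Rle_trans with (vnorm D (matvec D M v)).
  - apply sqrt_le_1_alt. rewrite <- (Ev a).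
    apply (Rsum_term_le D (fun k => Cnorm2 (matvec D M v k))); auto.
    intros; apply Cnorm2_nonneg.
  - apply opnorm_is_lub. exists v; split; auto. unfold vnorm.
    rewrite (Rsum_single _ _ b); auto.
    + unfold v; rewrite Nat.eqb_refl. unfold Cnorm2; simpl.
      replace (1 * 1 + 0 * 0) with 1 by ring. rewrite sqrt_1; lra.
    + intros k _ ne. unfold v; rewrite (proj2 (Nat.eqb_neq k b) ne).
      unfold Cnorm2; simpl; ring.
Qed.

(** On one site, [unit_mat 0 1] annihilates a flipped spin. On a block of sites, [unit_mat 1 0]
    sends the block vacuum to the state whose first site is flipped and kills every other basis
    state. *)
Definition unit_mat (x y : nat) : mat :=
  fun a b => if andb (Nat.eqb a x) (Nat.eqb b y) then C1 else C0.

Lemma opnorm_unit_mat D x y : (y < D)%nat -> opnorm D (unit_mat x y) <= 1.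
Proof.
  intros Hy. apply opnorm_is_lub. intros r [v [Hv ->]].
  assert (E : forall a, matvec D (unit_mat x y) v a = if Nat.eqb a x then v y else C0).
  { intros a. unfold matvec, unit_mat. destruct (Nat.eqb a x); simpl.
    - rewrite (Csum_single _ _ y); auto.
      + rewrite Nat.eqb_refl. apply Cx_ext; simpl; ring.
      + intros k _ ne. rewrite (proj2 (Nat.eqb_neq k y) ne). apply Cmul_0_l.
    - apply Csum_zero. intros; apply Cmul_0_l. }
  unfold vnorm at 1. rewrite <- sqrt_1. apply sqrt_le_1_alt.
  rewrite (Rsum_ext _ _ (fun a => if Nat.eqb a x then Cnorm2 (v y) else 0)).
  2:{ intros a _; rewrite E. destruct (Nat.eqb a x); auto. unfold Cnorm2; simpl; ring. }
  destruct (Nat.lt_ge_cases x D) as [Hx|Hx].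
  - rewrite (Rsum_single _ _ x); auto.
    + rewrite Nat.eqb_refl. eapply vnorm_le_1; eauto.
    + intros k _ ne. rewrite (proj2 (Nat.eqb_neq k x) ne). reflexivity.
  - rewrite Rsum_zero; [lra|]. intros k Hk. destruct (Nat.eqb_spec k x); auto; lia.
Qed.

(** * Spin operators as bit operations on basis indices *)

Local Open Scope nat_scope.

Lemma same_outside_bit k a b :
  (a mod 2 ^ k = b mod 2 ^ k /\ a / 2 ^ S k = b / 2 ^ S k) <->
  forall i, i <> k -> Nat.testbit a i = Nat.testbit b i.
Proof.
  split.
  - intros [Hm Hd] i ne. destruct (Nat.lt_ge_cases i k).
    + rewrite <- (Nat.mod_pow2_bits_low a k i), Hm, Nat.mod_pow2_bits_low by lia. auto.
    + replace i with ((i - S k) + S k) by lia. rewrite <- !Nat.div_pow2_bits, Hd. auto.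
  - intros H; split; apply Nat.bits_inj; intros i.
    + destruct (Nat.lt_ge_cases i k).
      * rewrite !Nat.mod_pow2_bits_low by lia. apply H; lia.
      * rewrite !Nat.mod_pow2_bits_high by lia. auto.
    + rewrite !Nat.div_pow2_bits. apply H; lia.
Qed.

Lemma embed_site k B a b :
  embed (S k) (S k) B a b =
  if andb (Nat.eqb (a mod 2 ^ k) (b mod 2 ^ k)) (Nat.eqb (a / 2 ^ S k) (b / 2 ^ S k))
  then B (Nat.b2n (Nat.testbit a k)) (Nat.b2n (Nat.testbit b k)) else C0.
Proof.
  unfold embed. replace (S k - 1) with k by lia. replace (S k - S k + 1) with 1 by lia.
  rewrite Nat.pow_1_r, !Nat.testbit_spec'. reflexivity.
Qed.

Lemma testbit_flip a k i :
  Nat.testbit (Nat.lxor a (2 ^ k)) i = xorb (Nat.testbit a i) (Nat.eqb k i).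
Proof. rewrite Nat.lxor_spec, Nat.pow2_bits_eqb. reflexivity. Qed.

(** A one-site matrix with zero diagonal connects [a] only to [a] with bit [k] flipped, so each row
    has a single relevant column and matrix products collapse. *)
Lemma embed_offdiag k B a b : B 0 0 = C0 -> B 1 1 = C0 ->
  embed (S k) (S k) B a b =
  if Nat.eqb b (Nat.lxor a (2 ^ k))
  then B (Nat.b2n (Nat.testbit a k)) (Nat.b2n (negb (Nat.testbit a k))) else C0.
Proof.
  intros H0 H1. rewrite embed_site.
  destruct (Nat.eqb_spec b (Nat.lxor a (2 ^ k))) as [->|ne].
  - assert (H : forall i, i <> k -> Nat.testbit a i = Nat.testbit (Nat.lxor a (2 ^ k)) i).
    { intros i ni. rewrite testbit_flip, (proj2 (Nat.eqb_neq k i)) by auto.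
      destruct (Nat.testbit a i); auto. }
    apply same_outside_bit in H. destruct H as [Hm Hd].
    rewrite Hm, Hd, !Nat.eqb_refl. cbn [andb]. rewrite testbit_flip, Nat.eqb_refl.
    destruct (Nat.testbit a k); auto.
  - destruct (Nat.eqb_spec (a mod 2 ^ k) (b mod 2 ^ k)) as [Hm|]; auto.
    destruct (Nat.eqb_spec (a / 2 ^ S k) (b / 2 ^ S k)) as [Hd|]; auto.
    cbn [andb].
    destruct (Bool.bool_dec (Nat.testbit a k) (Nat.testbit b k)) as [e|e].
    + rewrite e. destruct (Nat.testbit b k); auto.
    + exfalso; apply ne. apply Nat.bits_inj. intros i. rewrite testbit_flip.
      destruct (Nat.eqb_spec k i) as [->|ni].
      * destruct (Nat.testbit a i), (Nat.testbit b i); auto; congruence.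
      * rewrite (proj1 (same_outside_bit k a b) (conj Hm Hd) i) by auto.
        destruct (Nat.testbit b i); auto.
Qed.

Lemma embed_diag k B a b : B 0 1 = C0 -> B 1 0 = C0 ->
  embed (S k) (S k) B a b =
  if Nat.eqb b a
  then B (Nat.b2n (Nat.testbit a k)) (Nat.b2n (Nat.testbit a k)) else C0.
Proof.
  intros H0 H1. rewrite embed_site.
  destruct (Nat.eqb_spec b a) as [->|ne].
  - rewrite !Nat.eqb_refl. reflexivity.
  - destruct (Nat.eqb_spec (a mod 2 ^ k) (b mod 2 ^ k)) as [Hm|]; auto.
    destruct (Nat.eqb_spec (a / 2 ^ S k) (b / 2 ^ S k)) as [Hd|]; auto.
    cbn [andb].
    destruct (Bool.bool_dec (Nat.testbit a k) (Nat.testbit b k)) as [e|e].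
    + exfalso; apply ne. apply Nat.bits_inj. intros i.
      destruct (Nat.eq_dec i k) as [->|ni]; auto.
      symmetry. apply (proj1 (same_outside_bit k a b) (conj Hm Hd) i); auto.
    + destruct (Nat.testbit a k), (Nat.testbit b k); auto; congruence.
Qed.

Lemma lxor_pow2_lt a k n : a < 2 ^ n -> k < n -> Nat.lxor a (2 ^ k) < 2 ^ n.
Proof.
  intros Ha Hk.
  rewrite <- (Nat.mod_small a (2 ^ n)) by auto.
  rewrite <- (Nat.mod_small (2 ^ k) (2 ^ n)) by (apply Nat.pow_lt_mono_r; lia).
  assert (E : Nat.lxor (a mod 2 ^ n) (2 ^ k mod 2 ^ n) = Nat.lxor a (2 ^ k) mod 2 ^ n).
  { apply Nat.bits_inj. intros i. rewrite Nat.lxor_spec.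
    destruct (Nat.lt_ge_cases i n).
    - rewrite !Nat.mod_pow2_bits_low, Nat.lxor_spec by lia. auto.
    - rewrite !Nat.mod_pow2_bits_high by lia. auto. }
  rewrite E. apply Nat.mod_upper_bound, Nat.pow_nonzero. lia.
Qed.

(** Both products flip the two neighbouring spins. Their entries add up to [2] when the spins are
    opposite and cancel when they agree. *)
Lemma hop_entry n k a b : a < 2 ^ n -> S k < n ->
  Cadd (matmul (2 ^ n) (embed (S k) (S k) sx) (embed (S (S k)) (S (S k)) sx) a b)
       (matmul (2 ^ n) (embed (S k) (S k) sy) (embed (S (S k)) (S (S k)) sy) a b) =
  if andb (Nat.eqb b (Nat.lxor (Nat.lxor a (2 ^ k)) (2 ^ S k)))
          (xorb (Nat.testbit a k) (Nat.testbit a (S k)))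
  then mkC 2 0 else C0.
Proof.
  intros Ha Hk.
  assert (G : forall B, B 0 0 = C0 -> B 1 1 = C0 ->
    matmul (2 ^ n) (embed (S k) (S k) B) (embed (S (S k)) (S (S k)) B) a b =
    if Nat.eqb b (Nat.lxor (Nat.lxor a (2 ^ k)) (2 ^ S k)) then
      Cmul (B (Nat.b2n (Nat.testbit a k)) (Nat.b2n (negb (Nat.testbit a k))))
           (B (Nat.b2n (Nat.testbit a (S k))) (Nat.b2n (negb (Nat.testbit a (S k)))))
    else C0).
  { intros B B0 B1. unfold matmul. rewrite (Csum_single _ _ (Nat.lxor a (2 ^ k))).
    - rewrite !embed_offdiag, Nat.eqb_refl, testbit_flip by auto.
      rewrite (proj2 (Nat.eqb_neq k (S k))) by lia. rewrite Bool.xorb_false_r.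
      destruct (Nat.eqb _ _); auto. apply Cmul_0_r.
    - apply lxor_pow2_lt; lia.
    - intros c _ ne. rewrite embed_offdiag by auto.
      rewrite (proj2 (Nat.eqb_neq c _)) by auto. apply Cmul_0_l. }
  rewrite !G by reflexivity.
  destruct (Nat.eqb _ _); [|apply Cx_ext; simpl; ring].
  destruct (Nat.testbit a k), (Nat.testbit a (S k)); apply Cx_ext; simpl; ring.
Qed.

Local Open Scope R_scope.

(** * The Hamiltonian on the vacuum and on one flipped spin *)

Definition vac_energy (V : nat -> R) (n : nat) : R := Rsum n (fun k => V (S k)).

Lemma Hxy_diag_part lam om n a b :
  Csum n (fun k => Cscale (Vfib lam om (S k)) (embed (S k) (S k) sz a b)) =
  if Nat.eqb b a then
    mkC (Rsum n (fun k => Vfib lam om (S k) * if Nat.testbit a k then -1 else 1)) 0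
  else C0.
Proof.
  rewrite (Csum_ext _ _ (fun k => if Nat.eqb b a then
     mkC (Vfib lam om (S k) * if Nat.testbit a k then -1 else 1) 0 else C0)).
  - destruct (Nat.eqb b a).
    + apply Cx_ext; rewrite ?Cre_Csum, ?Cim_Csum; cbn [Cre Cim]; auto.
      apply Rsum_zero; auto.
    + apply Csum_zero; auto.
  - intros k _. rewrite embed_diag by reflexivity.
    destruct (Nat.eqb b a); [|apply Cx_ext; simpl; ring].
    destruct (Nat.testbit a k); apply Cx_ext; simpl; ring.
Qed.

Lemma pow2_pos n : (0 < 2 ^ n)%nat.
Proof. pose proof (Nat.pow_nonzero 2 n). lia. Qed.

Lemma pow2_inj i j : (2 ^ i = 2 ^ j)%nat -> i = j.
Proof. apply Nat.pow_inj_r; lia. Qed.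

Lemma pow2_lt i n : (i < n)%nat -> (2 ^ i < 2 ^ n)%nat.
Proof. intros; apply Nat.pow_lt_mono_r; lia. Qed.

Lemma eqb_pow2 i j : Nat.eqb (2 ^ i) (2 ^ j) = Nat.eqb i j.
Proof.
  destruct (Nat.eqb_spec i j) as [->|ne]; [apply Nat.eqb_refl|].
  apply Nat.eqb_neq. intros H; apply ne, pow2_inj, H.
Qed.

Lemma Hxy_vacuum lam om n b :
  Hxy lam om n 0%nat b = if Nat.eqb b 0 then mkC (vac_energy (Vfib lam om) n) 0 else C0.
Proof.
  unfold Hxy. rewrite Hxy_diag_part, Csum_zero.
  - destruct (Nat.eqb b 0); apply Cx_ext; simpl; try ring.
    rewrite Rplus_0_l. apply Rsum_ext. intros; rewrite Nat.bits_0; ring.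
  - intros k Hk. cbv zeta. rewrite hop_entry by (try apply pow2_pos; lia).
    rewrite !Nat.bits_0. cbn [xorb]. rewrite Bool.andb_false_r.
    apply Cx_ext; simpl; ring.
Qed.

(** The entry between [2 ^ i] and [2 ^ m] of the bond joining bits [k] and [k + 1], including the
    minus sign of the Hamiltonian. *)
Definition hop_coef (k i m : nat) : R :=
  (if andb (Nat.eqb k i) (Nat.eqb m (S k)) then -2 else 0) +
  (if andb (Nat.eqb (S k) i) (Nat.eqb m k) then -2 else 0).

(** The flipped spin makes the two ends of a bond differ exactly when it sits on that bond, and the
    double flip then moves it to the other end. *)
Lemma flip_one_particle i k b :
  andb (Nat.eqb b (Nat.lxor (Nat.lxor (2 ^ i) (2 ^ k)) (2 ^ S k)))
       (xorb (Nat.eqb i k) (Nat.eqb i (S k))) =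
  orb (andb (Nat.eqb k i) (Nat.eqb b (2 ^ S k)))
      (andb (Nat.eqb (S k) i) (Nat.eqb b (2 ^ k))).
Proof.
  rewrite (Nat.eqb_sym i k), (Nat.eqb_sym i (S k)).
  destruct (Nat.eqb_spec k i) as [->|n1].
  - rewrite (proj2 (Nat.eqb_neq (S i) i)) by lia.
    rewrite Nat.lxor_nilpotent, Nat.lxor_0_l.
    rewrite Bool.andb_true_r, Bool.andb_true_l, Bool.orb_false_r. reflexivity.
  - destruct (Nat.eqb_spec (S k) i) as [<-|n2].
    + rewrite (Nat.lxor_comm (2 ^ S k) (2 ^ k)), Nat.lxor_assoc, Nat.lxor_nilpotent, Nat.lxor_0_r.
      rewrite Bool.andb_true_r. reflexivity.
    + rewrite Bool.andb_false_r. reflexivity.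
Qed.

Lemma Hxy_one_particle lam om n i m : (i < n)%nat ->
  Hxy lam om n (2 ^ i)%nat (2 ^ m)%nat =
  mkC (Rsum (n - 1) (fun k => hop_coef k i m) +
       if Nat.eqb m i then vac_energy (Vfib lam om) n - 2 * Vfib lam om (S i) else 0) 0.
Proof.
  intros Hi. unfold Hxy. rewrite Hxy_diag_part, eqb_pow2.
  rewrite (Csum_ext _ _ (fun k => mkC (hop_coef k i m) 0)).
  - apply Cx_ext; cbn [Cadd Cre Cim]; rewrite ?Cre_Csum, ?Cim_Csum; cbn [Cre Cim].
    + f_equal. destruct (Nat.eqb_spec m i) as [->|]; [|reflexivity]. cbn [Cre].
      unfold vac_energy.
      rewrite (Rsum_ext _ _ (fun k => Vfib lam om (S k) +
        (if Nat.eqb k i then - 2 * Vfib lam om (S i) else 0))).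
      * rewrite Rsum_plus, (Rsum_single n (fun k => if Nat.eqb k i then _ else 0) i); auto.
        -- rewrite Nat.eqb_refl; ring.
        -- intros k _ ne. rewrite (proj2 (Nat.eqb_neq k i) ne). reflexivity.
      * intros k _. rewrite Nat.pow2_bits_eqb, Nat.eqb_sym.
        destruct (Nat.eqb_spec k i) as [->|]; ring.
    + rewrite Rsum_zero by auto. destruct (Nat.eqb m i); simpl; ring.
  - intros k Hk. cbv zeta. rewrite hop_entry by (try apply pow2_lt; lia).
    rewrite !Nat.pow2_bits_eqb, flip_one_particle, !eqb_pow2. unfold hop_coef.
    destruct (Nat.eqb_spec k i), (Nat.eqb_spec (S k) i), (Nat.eqb_spec m (S k)),
      (Nat.eqb_spec m k); try lia; apply Cx_ext; simpl; ring.
Qed.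

Lemma Hxy_leave_sector lam om n i b : (i < n)%nat ->
  (forall m, (m < n)%nat -> b <> (2 ^ m)%nat) -> Hxy lam om n (2 ^ i)%nat b = C0.
Proof.
  intros Hi Hb. unfold Hxy. rewrite Hxy_diag_part, Csum_zero.
  - rewrite (proj2 (Nat.eqb_neq b (2 ^ i))) by auto. apply Cx_ext; simpl; ring.
  - intros k Hk. cbv zeta. rewrite hop_entry by (try apply pow2_lt; lia).
    rewrite !Nat.pow2_bits_eqb, flip_one_particle.
    rewrite (proj2 (Nat.eqb_neq b (2 ^ S k))), (proj2 (Nat.eqb_neq b (2 ^ k))) by (apply Hb; lia).
    rewrite !Bool.andb_false_r. apply Cx_ext; simpl; ring.
Qed.

Lemma Csum_split a b f :
  Csum (a + b) f = Cadd (Csum a f) (Csum b (fun k => f (a + k)%nat)).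
Proof.
  induction b.
  - rewrite Nat.add_0_r. apply Cx_ext; simpl; ring.
  - rewrite Nat.add_succ_r. cbn [Csum]. rewrite IHb. apply Cx_ext; simpl; ring.
Qed.

(** Doubling the range from [2 ^ n] to [2 ^ S n] adds exactly one power of two, namely [2 ^ n]. *)
Lemma Csum_one_particle n f :
  (forall c, (c < 2 ^ n)%nat -> (forall i, (i < n)%nat -> c <> (2 ^ i)%nat) -> f c = C0) ->
  Csum (2 ^ n) f = Csum n (fun i => f (2 ^ i)%nat).
Proof.
  induction n; intros H.
  - simpl. rewrite (H 0%nat) by (simpl; intros; lia). apply Cx_ext; simpl; ring.
  - cbn [Csum]. replace (2 ^ S n)%nat with (2 ^ n + 2 ^ n)%nat by (simpl; lia).
    rewrite Csum_split, IHn.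
    + f_equal. rewrite (Csum_single _ _ 0%nat).
      * rewrite Nat.add_0_r. reflexivity.
      * apply pow2_pos.
      * intros k Hk ne. apply H.
        -- simpl; lia.
        -- intros i Hi E. assert (2 ^ i <= 2 ^ n)%nat by (apply Nat.pow_le_mono_r; lia). lia.
    + intros c Hc Hne. apply H.
      * simpl; lia.
      * intros i Hi. destruct (Nat.eq_dec i n) as [->|]; [lia|]. apply Hne; lia.
Qed.

Lemma matpow_vacuum lam om n s p b :
  matpow (2 ^ n) (matscale (mkC 0 s) (Hxy lam om n)) p 0%nat b =
  if Nat.eqb b 0 then Cpow (mkC 0 (s * vac_energy (Vfib lam om) n)) p else C0.
Proof.
  revert b. induction p; intros b.
  - cbn [matpow Cpow]. unfold matid. rewrite Nat.eqb_sym. reflexivity.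
  - cbn [matpow]. unfold matmul. rewrite (Csum_single _ _ 0%nat).
    + rewrite IHp. unfold matscale. rewrite Hxy_vacuum.
      destruct (Nat.eqb b 0); cbn [Nat.eqb Cpow]; apply Cx_ext; simpl; ring.
    + apply pow2_pos.
    + intros k _ ne. rewrite IHp, (proj2 (Nat.eqb_neq k 0) ne). apply Cmul_0_l.
Qed.

Lemma expm_vacuum lam om n s b :
  expm (2 ^ n) (matscale (mkC 0 s) (Hxy lam om n)) 0%nat b =
  if Nat.eqb b 0 then mkC (cos (s * vac_energy (Vfib lam om) n))
                          (sin (s * vac_energy (Vfib lam om) n)) else C0.
Proof.
  unfold expm. apply Clim_eq. set (x := s * vac_energy (Vfib lam om) n).
  assert (E : forall N, Csum N (fun k => Cscale (/ INR (fact k))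
       (matpow (2 ^ n) (matscale (mkC 0 s) (Hxy lam om n)) k 0%nat b)) =
     if Nat.eqb b 0 then
       Csum N (fun p => Cscale (x ^ p / INR (fact p)) (Cpow Ci p)) else C0).
  { intros N. destruct (Nat.eqb b 0) eqn:Eb.
    - apply Csum_ext; intros p _. rewrite matpow_vacuum, Eb. fold x.
      rewrite Cpow_imag. apply Cx_ext; simpl; unfold Rdiv; ring.
    - apply Csum_zero; intros p _. rewrite matpow_vacuum, Eb. apply Cx_ext; simpl; ring. }
  destruct (Nat.eqb b 0).
  - destruct (exp_imag_series x) as [H1 H2].
    split; [revert H1|revert H2]; apply Un_cv_ext; intros; rewrite E; auto.
  - split; apply Un_cv_ext with (fun _ => 0); try apply Un_cv_const;
      intros; rewrite E; auto.
Qed.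

Section OneParticle.
Context (lam om : R) (n : nat) (E : nat -> R) (psi : nat -> nat -> R).
Hypothesis basis : eigenbasis (Vfib lam om) n E psi.

Let H := Hxy lam om n.
Let h (k : nat) : R := vac_energy (Vfib lam om) n - 2 * E k.
Let w (j m k : nat) : R := psi k (S j) * psi k (S m).

(** The end sites lack one bond; the missing term is supplied by the zero boundary values of
    [psi]. *)
Lemma hop_row k m : (k < n)%nat -> (m < n)%nat ->
  Rsum n (fun i => psi k (S i) * Rsum (n - 1) (fun l => hop_coef l i m)) =
  - 2 * (psi k (S (S m)) + psi k m).
Proof.
  intros Hk Hm.
  transitivity (Rsum (n - 1) (fun l =>
    (if Nat.eqb m (S l) then - 2 * psi k (S l) else 0) +
    (if Nat.eqb m l then - 2 * psi k (S (S l)) else 0))).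
  - rewrite (Rsum_ext _ _ (fun i => Rsum (n - 1) (fun l => psi k (S i) * hop_coef l i m)))
      by (intros; rewrite Rsum_scal; reflexivity).
    rewrite Rsum_swap. apply Rsum_ext. intros l Hl. unfold hop_coef.
    rewrite (Rsum_ext _ _ (fun i =>
      (if andb (Nat.eqb l i) (Nat.eqb m (S l)) then - 2 * psi k (S i) else 0) +
      (if andb (Nat.eqb (S l) i) (Nat.eqb m l) then - 2 * psi k (S i) else 0)))
      by (intros; destruct (andb _ _), (andb _ _); ring).
    rewrite Rsum_plus. f_equal.
    + rewrite (Rsum_single _ _ l) by
        (try lia; intros i _ ne; rewrite (proj2 (Nat.eqb_neq l i)) by auto; reflexivity).
      rewrite Nat.eqb_refl. reflexivity.
    + rewrite (Rsum_single _ _ (S l)) by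
        (try lia; intros i _ ne; rewrite (proj2 (Nat.eqb_neq (S l) i)) by auto; reflexivity).
      rewrite Nat.eqb_refl. reflexivity.
  - destruct (eb_bdry _ _ _ _ basis k Hk) as [B0 B1].
    rewrite Rsum_plus, Rmult_plus_distr_l, Rplus_comm. f_equal.
    + destruct (Nat.eq_dec m (n - 1)) as [e|ne].
      * replace (S (S m)) with (S n) by lia. rewrite B1, Rsum_zero; [ring|].
        intros l Hl. rewrite (proj2 (Nat.eqb_neq m l)) by lia. reflexivity.
      * rewrite (Rsum_single _ _ m), Nat.eqb_refl; auto; [lia|].
        intros l Hl nl. rewrite (proj2 (Nat.eqb_neq m l)) by lia. reflexivity.
    + destruct m as [|m].
      * rewrite B0, Rsum_zero; [ring|]. reflexivity.
      * rewrite (Rsum_single _ _ m), Nat.eqb_refl; auto; [lia|].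
        intros l Hl nl. rewrite (proj2 (Nat.eqb_neq (S m) (S l))) by lia. reflexivity.
Qed.

(** Stated for row vectors because [matpow] multiplies by the new factor on the right. *)
Lemma one_particle_eigen k m : (k < n)%nat -> (m < n)%nat ->
  Rsum n (fun i => psi k (S i) * Cre (H (2 ^ i)%nat (2 ^ m)%nat)) = h k * psi k (S m).
Proof.
  intros Hk Hm.
  rewrite (Rsum_ext _ _ (fun i => psi k (S i) * Rsum (n - 1) (fun l => hop_coef l i m) +
     (if Nat.eqb m i then psi k (S i) *
        (vac_energy (Vfib lam om) n - 2 * Vfib lam om (S i)) else 0))).
  2:{ intros i Hi. unfold H. rewrite Hxy_one_particle by auto. cbn [Cre].
      destruct (Nat.eqb m i); ring. }
  rewrite Rsum_plus, hop_row by auto.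
  rewrite (Rsum_single _ _ m), Nat.eqb_refl; auto.
  - pose proof (eb_rec _ _ _ _ basis k m Hk Hm). unfold h.
    rewrite Rmult_minus_distr_r, Rmult_assoc, <- H0. ring.
  - intros l _ nl. rewrite (proj2 (Nat.eqb_neq m l)) by auto. reflexivity.
Qed.

(** The two claims are proved together: vanishing outside the sector is what restricts the next
    matrix product to powers of two. *)
Lemma matpow_one_particle s p j : (j < n)%nat ->
  (forall m, (m < n)%nat ->
    matpow (2 ^ n) (matscale (mkC 0 s) H) p (2 ^ j)%nat (2 ^ m)%nat =
    Cscale (Rsum n (fun k => h k ^ p * w j m k)) (Cpow (mkC 0 s) p)) /\
  (forall b, (forall m, (m < n)%nat -> b <> (2 ^ m)%nat) ->
    matpow (2 ^ n) (matscale (mkC 0 s) H) p (2 ^ j)%nat b = C0).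
Proof.
  intros Hj. induction p as [|p [IH1 IH2]].
  - split.
    + intros m Hm. cbn [matpow Cpow]. unfold matid. rewrite eqb_pow2.
      rewrite (Rsum_ext _ _ (fun k => psi k (S j) * psi k (S m)))
        by (intros; unfold w; simpl; ring).
      rewrite (eb_complete _ _ _ _ basis) by auto.
      destruct (Nat.eqb j m); apply Cx_ext; simpl; ring.
    + intros b Hb. cbn [matpow]. unfold matid.
      rewrite (proj2 (Nat.eqb_neq (2 ^ j) b)); auto. intros e; apply (Hb j); auto.
  - assert (S0 : forall b, matpow (2 ^ n) (matscale (mkC 0 s) H) (S p) (2 ^ j)%nat b =
      Csum n (fun i => Cmul
        (Cscale (Rsum n (fun k => h k ^ p * w j i k)) (Cpow (mkC 0 s) p))
        (Cmul (mkC 0 s) (H (2 ^ i)%nat b)))).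
    { intros b. cbn [matpow]. unfold matmul.
      rewrite Csum_one_particle.
      - apply Csum_ext; intros i Hi. rewrite IH1 by auto. reflexivity.
      - intros c _ Hc. rewrite IH2 by auto. apply Cmul_0_l. }
    split.
    + intros m Hm. rewrite S0.
      assert (R0 : Rsum n (fun i => Rsum n (fun k => h k ^ p * w j i k) *
                Cre (H (2 ^ i)%nat (2 ^ m)%nat)) = Rsum n (fun k => h k ^ S p * w j m k)).
      { rewrite (Rsum_ext _ _ (fun i => Rsum n (fun k => h k ^ p * psi k (S j) *
          (psi k (S i) * Cre (H (2 ^ i)%nat (2 ^ m)%nat))))).
        - rewrite Rsum_swap. apply Rsum_ext; intros k Hk.
          rewrite Rsum_scal, one_particle_eigen by auto. unfold w; simpl; ring.
        - intros i _. rewrite Rmult_comm, <- Rsum_scal. apply Rsum_ext; intros.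
          unfold w; ring. }
      rewrite <- R0.
      assert (Z : forall i, (i < n)%nat -> Cim (H (2 ^ i)%nat (2 ^ m)%nat) = 0).
      { intros i Hi. unfold H. rewrite Hxy_one_particle by auto. reflexivity. }
      apply Cx_ext; rewrite ?Cre_Csum, ?Cim_Csum; cbn [Cpow Cscale Cre Cim];
        rewrite Rmult_comm, <- Rsum_scal; apply Rsum_ext; intros i Hi;
        cbn [Cmul Cscale Cre Cim]; rewrite Z by auto; ring.
    + intros b Hb. rewrite S0. apply Csum_zero; intros i Hi. unfold H.
      rewrite Hxy_leave_sector by auto. rewrite !Cmul_0_r. reflexivity.
Qed.

Lemma expm_one_particle s j m : (j < n)%nat -> (m < n)%nat ->
  expm (2 ^ n) (matscale (mkC 0 s) H) (2 ^ j)%nat (2 ^ m)%nat = wave n h (w j m) s.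
Proof.
  intros Hj Hm. unfold expm. apply Clim_eq.
  destruct (wave_series n h (w j m) s) as [H1 H2].
  assert (Eq : forall N, Csum N (fun p => Cscale (s ^ p / INR (fact p) *
        Rsum n (fun k => h k ^ p * w j m k)) (Cpow Ci p)) =
     Csum N (fun k => Cscale (/ INR (fact k))
       (matpow (2 ^ n) (matscale (mkC 0 s) H) k (2 ^ j)%nat (2 ^ m)%nat))).
  { intros N. apply Csum_ext; intros p _.
    rewrite (proj1 (matpow_one_particle s p j Hj)) by auto.
    rewrite Cpow_imag. apply Cx_ext; simpl; unfold Rdiv; ring. }
  split; [revert H1|revert H2]; apply Un_cv_ext; intros; rewrite Eq; auto.
Qed.

(** Matrix element between vacuum states of the commutator of the evolved
    annihilator at site [j+1] with the creator at site [m+1]. *)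
Lemma vacuum_commutator t j m : (j < m)%nat -> (m < n)%nat ->
  Cnorm2 (commutator (2 ^ n) (tau lam om n t (embed (S j) (S j) (unit_mat 0 1)))
     (embed (S m) n (unit_mat 1 0)) 0%nat 0%nat) = Cnorm2 (wave n E (w j m) (2 * t)).
Proof.
  intros Hjm Hm. set (x := t * vac_energy (Vfib lam om) n).
  (* The vacuum row of the first exponential is a phase at the vacuum, and the annihilator turns row
     [0] into row [2 ^ j]. *)
  assert (T : forall b,
    tau lam om n t (embed (S j) (S j) (unit_mat 0 1)) 0%nat b =
    Cmul (mkC (cos x) (sin x)) (expm (2 ^ n) (matscale (mkC 0 (- t)) H) (2 ^ j)%nat b)).
  { intros b. unfold tau, matmul at 1. rewrite (Csum_single _ _ (2 ^ j)%nat).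
    - f_equal. unfold matmul. rewrite (Csum_single _ _ 0%nat).
      + rewrite expm_vacuum, embed_offdiag by reflexivity. fold x.
        rewrite Nat.lxor_0_l, !Nat.eqb_refl, Nat.bits_0. apply Cx_ext; simpl; ring.
      + apply pow2_pos.
      + intros k _ ne. rewrite expm_vacuum, (proj2 (Nat.eqb_neq k 0) ne). apply Cmul_0_l.
    - apply pow2_lt; lia.
    - intros l _ ne. unfold matmul. rewrite Csum_zero; [apply Cmul_0_l|].
      intros k _. rewrite expm_vacuum, embed_offdiag by reflexivity.
      destruct (Nat.eqb_spec k 0) as [->|]; [|apply Cmul_0_l].
      rewrite Nat.lxor_0_l, (proj2 (Nat.eqb_neq l _) ne). apply Cmul_0_r. }
  (* The creator has a zero vacuum row, so only the first product of the commutator contributes. *)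
  assert (B0 : forall b, embed (S m) n (unit_mat 1 0) 0%nat b = C0).
  { intros b. unfold embed. destruct (andb _ _); auto.
    rewrite Nat.Div0.div_0_l, Nat.Div0.mod_0_l. reflexivity. }
  assert (B1 : forall b, (b < 2 ^ n)%nat -> embed (S m) n (unit_mat 1 0) b 0%nat =
                if Nat.eqb b (2 ^ m) then C1 else C0).
  { intros b Hb. unfold embed. replace (S m - 1)%nat with m by lia.
    replace (n - S m + 1)%nat with (n - m)%nat by lia.
    rewrite !Nat.Div0.div_0_l, !Nat.Div0.mod_0_l, (Nat.div_small b) by auto.
    rewrite Nat.eqb_refl, Bool.andb_true_r.
    assert (P : (2 ^ n = 2 ^ m * 2 ^ (n - m))%nat)
      by (rewrite <- Nat.pow_add_r; f_equal; lia).
    pose proof (pow2_pos m).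
    assert (D : (b / 2 ^ m < 2 ^ (n - m))%nat)
      by (apply Nat.Div0.div_lt_upper_bound; lia).
    rewrite (Nat.mod_small (b / 2 ^ m)) by auto. unfold unit_mat.
    rewrite Nat.eqb_refl, Bool.andb_true_r.
    pose proof (Nat.div_mod_eq b (2 ^ m)) as Q.
    destruct (Nat.eqb_spec b (2 ^ m)) as [->|ne].
    - rewrite Nat.Div0.mod_same, Nat.div_same by lia. reflexivity.
    - destruct (Nat.eqb_spec (b mod 2 ^ m) 0); auto.
      destruct (Nat.eqb_spec (b / 2 ^ m) 1) as [e1|]; auto.
      exfalso; apply ne. rewrite Q, e1, e. lia. }
  unfold commutator, matsub, Csub.
  replace (matmul (2 ^ n) (embed (S m) n (unit_mat 1 0))
     (tau lam om n t (embed (S j) (S j) (unit_mat 0 1))) 0%nat 0%nat) with C0.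
  2:{ symmetry. unfold matmul at 1. apply Csum_zero; intros. rewrite B0. apply Cmul_0_l. }
  unfold matmul. rewrite (Csum_single _ _ (2 ^ m)%nat).
  - rewrite B1, Nat.eqb_refl, T, expm_one_particle by (try apply pow2_lt; lia).
    transitivity (Cnorm2 (mkC (cos x) (sin x)) * Cnorm2 (wave n h (w j m) (- t))).
    + rewrite <- Cnorm2_mul. generalize (wave n h (w j m) (- t)). intros z.
      unfold Cnorm2; simpl. ring.
    + unfold Cnorm2 at 1. cbn [Cre Cim].
      pose proof (sin2_cos2 x) as SC. unfold Rsqr in SC.
      replace (cos x * cos x + sin x * sin x) with 1 by lra.
      rewrite Rmult_1_l, !wave_norm2.
      (* The vacuum energy drops out of differences, and [- t * (h k - h l) = 2 * t * (E k - E l)]: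
         this is the origin of the doubled time. *)
      apply Rsum_ext; intros k _. apply Rsum_ext; intros l _. f_equal. f_equal.
      unfold h. ring.
  - apply pow2_lt; lia.
  - intros b Hb ne. rewrite B1, (proj2 (Nat.eqb_neq b _) ne) by auto. apply Cmul_0_r.
Qed.

End OneParticle.

(** A matrix entry is at most the operator norm, and both observables have norm at most [1]. *)
Lemma LR_one_particle lam om alpha : LR lam om alpha ->
  exists C mu v, 0 < C /\ 0 < mu /\ 0 <= v /\
  forall n E psi j m t, eigenbasis (Vfib lam om) n E psi ->
    (j < m)%nat -> (m < n)%nat -> 0 < t ->
    sqrt (Cnorm2 (wave n E (fun k => psi k (S j) * psi k (S m)) (2 * t))) <=
    C * exp (- mu * (INR (m - j) - v * Rpower t alpha)).
Proof.
  intros (C & mu & v & HC & Hmu & Hv & HLR). exists C, mu, v.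
  repeat split; auto. intros n E psi j m t basis Hjm Hm Ht.
  rewrite <- (vacuum_commutator lam om n E psi basis t j m) by auto.
  eapply Rle_trans; [apply opnorm_entry; apply pow2_pos|].
  eapply Rle_trans; [apply HLR; lia || auto|].
  replace (S m - S j)%nat with (m - j)%nat by lia.
  apply Rmult_le_compat_r; [left; apply exp_pos|].
  pose proof (opnorm_nonneg 2 (unit_mat 0 1)).
  pose proof (opnorm_nonneg (2 ^ (n - S m + 1)) (unit_mat 1 0)).
  pose proof (opnorm_unit_mat 2 0 1 ltac:(lia)).
  pose proof (opnorm_unit_mat (2 ^ (n - S m + 1)) 1 0 (pow2_pos _)).
  rewrite Rmult_assoc. rewrite <- (Rmult_1_r C) at 2.
  apply Rmult_le_compat_l; [lra|]. nra.
Qed.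

(** * Transport on the half line *)

Lemma Un_cv_le u l B : (forall n, u n <= B) -> Un_cv u l -> l <= B.
Proof. intros H Hu. exact (Rle_cv_lim H Hu (Un_cv_const B)). Qed.

Lemma Vfib_bound lam om m : 0 < lam -> 0 <= Vfib lam om m <= lam.
Proof.
  intros H. unfold Vfib. destruct (Rle_dec _ _); [destruct (Rlt_dec _ _)|]; lra.
Qed.

Lemma hop_bound lam x y z c K : 0 <= c <= lam -> Rabs x <= K -> Rabs y <= K ->
  Rabs z <= K -> Rabs (x + y + c * z) <= (2 + lam) * K.
Proof.
  intros Hc Hx Hy Hz.
  assert (Rabs (c * z) <= lam * K).
  { rewrite Rabs_mult, (Rabs_right c) by lra.
    apply Rmult_le_compat; auto using Rabs_pos; lra. }
  pose proof (Rabs_triang (x + y) (c * z)). pose proof (Rabs_triang x y). lra.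
Qed.

Lemma hvec_bound lam om k m : 0 < lam -> Rabs (hvec lam om k m) <= (2 + lam) ^ k.
Proof.
  intros Hl. revert m. induction k; intros m; simpl.
  - destruct (Nat.eqb m 1); rewrite ?Rabs_R1, ?Rabs_R0; lra.
  - destruct m.
    + rewrite Rabs_R0. apply (pow_le _ (S k)); lra.
    + apply hop_bound; auto. apply Vfib_bound; auto.
Qed.

Lemma hvec_support lam om k m : (S k < m)%nat -> hvec lam om k m = 0.
Proof.
  revert m. induction k; intros m Hm; simpl.
  - rewrite (proj2 (Nat.eqb_neq m 1)); auto; lia.
  - destruct m; auto. rewrite !IHk by lia. ring.
Qed.

(** * Moments of the truncated operator *)

Section FiniteVolume.
Context (lam om : R) (n : nat) (E : nat -> R) (psi : nat -> nat -> R).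
Hypothesis basis : eigenbasis (Vfib lam om) n E psi.
Hypothesis lam_pos : 0 < lam.

Let W (k m : nat) : R := Rsum n (fun l => E l ^ k * (psi l 1%nat * psi l m)).

Lemma moment_bdry k : W k 0%nat = 0 /\ W k (S n) = 0.
Proof.
  split; apply Rsum_zero; intros l Hl;
    destruct (eb_bdry _ _ _ _ basis l Hl) as [B0 B1]; rewrite ?B0, ?B1; ring.
Qed.

Lemma moment_0 m : (m < n)%nat -> W 0 (S m) = if Nat.eqb m 0 then 1 else 0.
Proof.
  intros Hm. rewrite Nat.eqb_sym.
  rewrite <- (eb_complete _ _ _ _ basis 0%nat m) by lia.
  apply Rsum_ext; intros; simpl; ring.
Qed.

Lemma moment_S k m : (m < n)%nat ->
  W (S k) (S m) = W k (S (S m)) + W k m + Vfib lam om (S m) * W k (S m).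
Proof.
  intros Hm. unfold W. rewrite <- Rsum_scal, <- !Rsum_plus.
  apply Rsum_ext; intros l Hl.
  pose proof (eb_rec _ _ _ _ basis l m Hl Hm) as H. cbn [pow].
  transitivity (E l ^ k * psi l 1%nat * (E l * psi l (S m))); [ring|].
  rewrite <- H; ring.
Qed.

(** Starting from site [1], [k < n] steps reach no site beyond [n], so the truncation is not yet
    felt. *)
Lemma moment_hvec k m : (k < n)%nat -> (m <= n)%nat -> W k m = hvec lam om k m.
Proof.
  revert m. induction k; intros m Hk Hm.
  - destruct m; [apply moment_bdry|]. rewrite moment_0 by lia. reflexivity.
  - destruct m; [apply moment_bdry|]. rewrite moment_S by lia. cbn [hvec].
    rewrite !(IHk m), !(IHk (S m)) by lia.
    destruct (Nat.eq_dec (S m) n) as [e|ne].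
    + rewrite e. rewrite (proj2 (moment_bdry k)), (hvec_support lam om k (S n)) by lia. ring.
    + rewrite IHk by lia. ring.
Qed.

(** Unlike the agreement with [hvec], this holds for every order [k]; it gives the finite chain the
    same exponential majorant as the half line. *)
Lemma moment_bound k m : (m <= S n)%nat -> Rabs (W k m) <= (2 + lam) ^ k.
Proof.
  revert m. induction k; intros m Hm;
    (destruct (Nat.eq_dec m 0) as [->|m0];
     [rewrite (proj1 (moment_bdry _)), Rabs_R0; apply pow_le; lra|]);
    (destruct (Nat.eq_dec m (S n)) as [->|mn];
     [rewrite (proj2 (moment_bdry _)), Rabs_R0; apply pow_le; lra|]);
    destruct m as [|m]; try lia.
  - rewrite moment_0 by lia. destruct (Nat.eqb m 0); rewrite ?Rabs_R1, ?Rabs_R0; simpl; lra.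
  - rewrite moment_S by lia. cbn [pow].
    apply hop_bound; try apply IHk; try lia. apply Vfib_bound; auto.
Qed.

End FiniteVolume.

(** * Series dominated by an exponential series *)

Definition exp_tail (x : R) (N : nat) : R := exp x - Rsum N (fun p => / INR (fact p) * x ^ p).

Lemma exp_partial_cv x : Un_cv (fun N => Rsum N (fun p => / INR (fact p) * x ^ p)) (exp x).
Proof. apply Rsum_infinite_sum. unfold exp. destruct (exist_exp x); auto. Qed.

Lemma exp_tail_cv x : Un_cv (exp_tail x) 0.
Proof.
  replace 0 with (exp x - exp x) by ring.
  apply (CV_minus (fun _ => exp x)); [apply Un_cv_const|apply exp_partial_cv].
Qed.

Lemma Rsum_add N d f : Rsum (N + d) f = Rsum N f + Rsum d (fun p => f (N + p)%nat).
Proof.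
  induction d; simpl; [rewrite Nat.add_0_r; ring|].
  rewrite Nat.add_succ_r; simpl. rewrite IHd; ring.
Qed.

Lemma Rsum_diff_le N d a r : (forall p, Rabs (a p) <= r p) ->
  Rabs (Rsum (N + d) a - Rsum N a) <= Rsum (N + d) r - Rsum N r.
Proof.
  intros H. rewrite !Rsum_add.
  replace (Rsum N a + _ - Rsum N a) with (Rsum d (fun p => a (N + p)%nat)) by ring.
  replace (Rsum N r + _ - Rsum N r) with (Rsum d (fun p => r (N + p)%nat)) by ring.
  induction d; simpl; [rewrite Rabs_R0; lra|].
  eapply Rle_trans; [apply Rabs_triang|]. apply Rplus_le_compat; auto.
Qed.

Lemma exp_partial_le x M : 0 <= x -> Rsum M (fun p => / INR (fact p) * x ^ p) <= exp x.
Proof.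
  intros Hx. apply (growing_ineq (fun M => Rsum M (fun p => / INR (fact p) * x ^ p))).
  - intros N. simpl. assert (0 <= / INR (fact N) * x ^ N); [|lra].
    apply Rmult_le_pos; [|apply pow_le; auto].
    left; apply Rinv_0_lt_compat, INR_fact_lt_0.
  - apply exp_partial_cv.
Qed.

Lemma partial_sum_tail x a N M : 0 <= x ->
  (forall p, Rabs (a p) <= / INR (fact p) * x ^ p) -> (N <= M)%nat ->
  Rabs (Rsum M a - Rsum N a) <= exp_tail x N.
Proof.
  intros Hx Ha HNM. replace M with (N + (M - N))%nat by lia.
  eapply Rle_trans; [apply Rsum_diff_le, Ha|]. unfold exp_tail.
  pose proof (exp_partial_le x (N + (M - N)) Hx). lra.
Qed.

Lemma limit_tail x a l N : 0 <= x ->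
  (forall p, Rabs (a p) <= / INR (fact p) * x ^ p) -> Un_cv (fun M => Rsum M a) l ->
  Rabs (l - Rsum N a) <= exp_tail x N.
Proof.
  intros Hx Ha Hl.
  apply (Un_cv_le (fun k => Rabs (Rsum (N + k) a - Rsum N a))).
  - intros k. apply partial_sum_tail; auto; lia.
  - apply cv_cvabs. apply (CV_minus (fun k => Rsum (N + k) a) (fun _ => Rsum N a));
      [|apply Un_cv_const].
    apply (Un_cv_comp (fun M => Rsum M a) l (fun k => N + k)%nat); auto.
    intros M; exists M; lia.
Qed.

Lemma exp_dominated_cv x a : 0 <= x ->
  (forall p, Rabs (a p) <= / INR (fact p) * x ^ p) ->
  exists l, Un_cv (fun M => Rsum M a) l.
Proof.
  intros Hx Ha. destruct (R_complete (fun M => Rsum M a)) as [l Hl]; [|eauto].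
  intros eps He. destruct (exp_tail_cv x eps He) as [N HN].
  assert (G : forall p q, (N <= p)%nat -> (p <= q)%nat ->
     Rdist (Rsum q a) (Rsum p a) < eps).
  { intros p q Hp Hq. eapply Rle_lt_trans; [apply (partial_sum_tail x); auto|].
    specialize (HN p Hp). unfold Rdist in HN. rewrite Rminus_0_r in HN.
    eapply Rle_lt_trans; [apply Rle_abs|exact HN]. }
  exists N; intros p q Hp Hq. destruct (Nat.le_ge_cases p q).
  - rewrite Rdist_sym. apply G; lia.
  - apply G; lia.
Qed.

Lemma Cpow_Ci_bound p : Rabs (Cre (Cpow Ci p)) <= 1 /\ Rabs (Cim (Cpow Ci p)) <= 1.
Proof.
  induction p as [|p [IH1 IH2]]; simpl.
  - rewrite Rabs_R1, Rabs_R0; lra.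
  - replace (Cre (Cpow Ci p) * 0 - Cim (Cpow Ci p) * 1) with (- Cim (Cpow Ci p)) by ring.
    replace (Cre (Cpow Ci p) * 1 + Cim (Cpow Ci p) * 0) with (Cre (Cpow Ci p)) by ring.
    rewrite Rabs_Ropp; auto.
Qed.

Lemma series_term_bound t y c p K : 0 <= t -> Rabs y <= K ^ p -> Rabs c <= 1 -> 0 <= K ->
  Rabs ((- t) ^ p / INR (fact p) * y * c) <= / INR (fact p) * (t * K) ^ p.
Proof.
  intros Ht Hy Hc HK. unfold Rdiv. rewrite !Rabs_mult, Rpow_mult_distr.
  rewrite <- RPow_abs, Rabs_Ropp, (Rabs_right t) by lra.
  rewrite (Rabs_right (/ INR (fact p))) by
    (left; apply Rinv_0_lt_compat, INR_fact_lt_0).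
  rewrite (Rmult_comm (t ^ p)), !Rmult_assoc.
  apply Rmult_le_compat_l; [left; apply Rinv_0_lt_compat, INR_fact_lt_0|].
  apply Rmult_le_compat_l; [apply pow_le; auto|].
  pose proof (Rabs_pos y). pose proof (Rabs_pos c). nra.
Qed.

Lemma amp_term lam om t k m :
  Cscale (t ^ k / INR (fact k) * hvec lam om k m) (Cpow (Copp Ci) k) =
  Cscale ((- t) ^ k / INR (fact k) * hvec lam om k m) (Cpow Ci k).
Proof.
  replace (Copp Ci) with (mkC 0 (-1)) by (apply Cx_ext; simpl; ring).
  rewrite Cpow_imag. replace (- t) with (t * -1) by ring. rewrite Rpow_mult_distr.
  apply Cx_ext; simpl; unfold Rdiv; ring.
Qed.

(** A finite chain agrees with the half line up to order [n - 1] in the time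
    expansion, so bounds that are uniform in [n] survive the limit. *)
Lemma amp_bound lam om t m B : 0 < lam -> 0 < t -> (1 <= m)%nat -> 0 <= B ->
  (forall n E psi, eigenbasis (Vfib lam om) n E psi -> (m <= n)%nat ->
     sqrt (Cnorm2 (wave n E (fun k => psi k 1%nat * psi k m) t)) <= B) ->
  (forall n, exists E psi, eigenbasis (Vfib lam om) n E psi) ->
  Cnorm2 (amp lam om t m) <= B * B.
Proof.
  intros Hl Ht Hm HB Hfin Hex. set (K := 2 + lam). set (x := t * K).
  assert (HK : 0 <= K) by (unfold K; lra).
  assert (Hx : 0 <= x) by (unfold x; nra).
  set (a := fun (c : nat -> R) p => (- t) ^ p / INR (fact p) * hvec lam om p m * c p).
  set (re := fun p => Cre (Cpow Ci p)). set (im := fun p => Cim (Cpow Ci p)).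
  assert (Da : forall c, (forall p, Rabs (c p) <= 1) ->
     forall p, Rabs (a c p) <= / INR (fact p) * x ^ p).
  { intros c Hc p. apply series_term_bound; auto; [lra|apply hvec_bound; auto]. }
  assert (Hre : forall p, Rabs (re p) <= 1) by (intros; apply Cpow_Ci_bound).
  assert (Him : forall p, Rabs (im p) <= 1) by (intros; apply Cpow_Ci_bound).
  destruct (exp_dominated_cv x (a re) Hx (Da re Hre)) as [zr Hr].
  destruct (exp_dominated_cv x (a im) Hx (Da im Him)) as [zi Hi].
  assert (Ez : amp lam om t m = mkC zr zi).
  { unfold amp. apply Clim_eq. split; cbn [Cre Cim]; [revert Hr|revert Hi];
      apply Un_cv_ext; intros N; rewrite ?Cre_Csum, ?Cim_Csum;
      apply Rsum_ext; intros; rewrite amp_term; reflexivity. }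
  assert (Happ : forall N, exists y, Cnorm2 y <= B * B /\
      Rabs (Cre y - Rsum N (a re)) <= exp_tail x N /\
      Rabs (Cim y - Rsum N (a im)) <= exp_tail x N).
  (* With [N + m] sites the first [N] terms agree with those of the half line, so both series differ
     from the same partial sum by at most the tail. *)
  { intros N. set (n := (N + m)%nat). destruct (Hex n) as (E & psi & basis).
    exists (wave n E (fun k => psi k 1%nat * psi k m) (- t)).
    set (b := fun (c : nat -> R) p => (- t) ^ p / INR (fact p) *
                Rsum n (fun l => E l ^ p * (psi l 1%nat * psi l m)) * c p).
    assert (Db : forall c, (forall p, Rabs (c p) <= 1) ->
       forall p, Rabs (b c p) <= / INR (fact p) * x ^ p).
    { intros c Hc p. apply series_term_bound; auto; [lra|].
      apply (moment_bound lam om n E psi basis Hl). unfold n; lia. }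
    assert (Eab : forall c, Rsum N (a c) = Rsum N (b c)).
    { intros c. apply Rsum_ext; intros p Hp. unfold a, b.
      rewrite (moment_hvec lam om n E psi basis) by (unfold n; lia). reflexivity. }
    split; [|split].
    - pose proof (Hfin n E psi basis ltac:(unfold n; lia)) as Hb.
      (* The weights are real, so reversing time conjugates the propagator. *)
      assert (Hsym : Cnorm2 (wave n E (fun k => psi k 1%nat * psi k m) (- t)) =
                     Cnorm2 (wave n E (fun k => psi k 1%nat * psi k m) t)).
      { unfold Cnorm2, wave; cbn [Cre Cim].
        assert (S1 : forall k, cos (- t * E k) = cos (t * E k))
          by (intros; rewrite Ropp_mult_distr_l_reverse; apply cos_neg).
        assert (S2 : forall k, sin (- t * E k) = - sin (t * E k))
          by (intros; rewrite Ropp_mult_distr_l_reverse; apply sin_neg).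
        rewrite (Rsum_ext n (fun k => _ * cos (- t * E k))
          (fun k => psi k 1%nat * psi k m * cos (t * E k))) by (intros; rewrite S1; ring).
        rewrite (Rsum_ext n (fun k => _ * sin (- t * E k))
          (fun k => -1 * (psi k 1%nat * psi k m * sin (t * E k)))) by (intros; rewrite S2; ring).
        rewrite Rsum_scal. ring. }
      rewrite Hsym.
      rewrite <- (sqrt_sqrt (Cnorm2 (wave n E _ t))) by apply Cnorm2_nonneg.
      pose proof (sqrt_pos (Cnorm2 (wave n E (fun k => psi k 1%nat * psi k m) t))).
      apply Rmult_le_compat; auto.
    - rewrite Eab. apply (limit_tail x (b re)); auto.
      destruct (wave_series n E (fun k => psi k 1%nat * psi k m) (- t)) as [H1 _].
      revert H1; apply Un_cv_ext; intros; rewrite Cre_Csum; reflexivity.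
    - rewrite Eab. apply (limit_tail x (b im)); auto.
      destruct (wave_series n E (fun k => psi k 1%nat * psi k m) (- t)) as [_ H1].
      revert H1; apply Un_cv_ext; intros; rewrite Cim_Csum; reflexivity. }
  set (y := fun N => proj1_sig (constructive_indefinite_description _ (Happ N))).
  assert (Hy : forall N, Cnorm2 (y N) <= B * B /\
      Rabs (Cre (y N) - Rsum N (a re)) <= exp_tail x N /\
      Rabs (Cim (y N) - Rsum N (a im)) <= exp_tail x N).
  { intros N. unfold y. destruct (constructive_indefinite_description _ _); auto. }
  assert (Hd : forall u v l, (forall N, Rabs (u N - v N) <= exp_tail x N) ->
     Un_cv v l -> Un_cv u l).
  { intros u v l Huv Hv.
    apply Un_cv_ext with (fun N => (u N - v N) + v N); [intros; ring|].
    replace l with (0 + l) by ring. apply (CV_plus (fun N => u N - v N) v); auto.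
    intros eps He. destruct (exp_tail_cv x eps He) as [N HN]. exists N; intros k Hk.
    specialize (HN k Hk). unfold Rdist in *. rewrite Rminus_0_r in *.
    eapply Rle_lt_trans; [apply Huv|]. eapply Rle_lt_trans; [apply Rle_abs|exact HN]. }
  assert (Yr : Un_cv (fun N => Cre (y N)) zr) by
    (apply (Hd _ (fun N => Rsum N (a re))); auto; intros; apply Hy).
  assert (Yi : Un_cv (fun N => Cim (y N)) zi) by
    (apply (Hd _ (fun N => Rsum N (a im))); auto; intros; apply Hy).
  rewrite Ez. unfold Cnorm2; cbn [Cre Cim].
  apply (Un_cv_le (fun N => Cnorm2 (y N))); [apply Hy|].
  apply (CV_plus (fun N => Cre (y N) * Cre (y N)) (fun N => Cim (y N) * Cim (y N)));
    [apply (CV_mult (fun N => Cre (y N)) (fun N => Cre (y N)))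
    |apply (CV_mult (fun N => Cim (y N)) (fun N => Cim (y N)))]; auto.
Qed.

(** * Decay of the outside probability *)

Lemma infinite_sum_le a l B :
  (forall N, sum_f_R0 a N <= B) -> infinite_sum a l -> l <= B.
Proof. intros H Ha. apply (Un_cv_le (sum_f_R0 a)); auto. Qed.

Lemma epsilon_sum_le a B : (forall m, 0 <= a m) -> (forall N, sum_f_R0 a N <= B) ->
  epsilon (inhabits 0) (infinite_sum a) <= B.
Proof.
  intros Ha HB. apply (infinite_sum_le a); auto. apply epsilon_spec.
  destruct (growing_cv (sum_f_R0 a)) as [l Hl].
  - intros N. simpl. specialize (Ha (S N)). lra.
  - exists B. intros x [N ->]. apply HB.
  - exists l; exact Hl.
Qed.

Lemma geometric_sum_le r N : 0 <= r < 1 -> sum_f_R0 (fun i => r ^ i) N <= / (1 - r).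
Proof.
  intros Hr. rewrite tech3 by lra. unfold Rdiv. rewrite <- (Rmult_1_l (/ (1 - r))) at 2.
  apply Rmult_le_compat_r; [left; apply Rinv_0_lt_compat; lra|].
  pose proof (pow_le r (S N) (proj1 Hr)). lra.
Qed.

Lemma exp_mult_INR x m : exp (x * INR m) = exp x ^ m.
Proof.
  induction m; [simpl; rewrite Rmult_0_r; apply exp_0|].
  rewrite S_INR, Rmult_plus_distr_l, Rmult_1_r, exp_plus, IHm. simpl; ring.
Qed.

(** The squared amplitude decays like [exp (- 2 * mu * m)]. Half of this rate is kept for the
    geometric series in [m]; the other half becomes [exp (- mu * N)] because [m > N]. The condition
    [1 <= N] leaves only sites [m >= 2], distinct from the starting site. *)
Lemma Pout_bound lam om t N C mu b : 0 < mu -> 1 <= N ->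
  (forall m, (2 <= m)%nat ->
     Cnorm2 (amp lam om t m) <= Rsqr (C * exp (- mu * (INR (m - 1) - b)))) ->
  Pout lam om N t <=
  C * C * exp (mu * 2 * b + 2 * mu - mu * N) * / (1 - exp (- mu)).
Proof.
  intros Hmu HN Hb. unfold Pout.
  assert (Hr : 0 <= exp (- mu) < 1).
  { split; [left; apply exp_pos|]. rewrite <- exp_0. apply exp_increasing; lra. }
  set (G := C * C * exp (mu * 2 * b + 2 * mu - mu * N)).
  assert (HG : 0 <= G).
  { apply Rmult_le_pos; [nra|left; apply exp_pos]. }
  apply epsilon_sum_le.
  - intros m. destruct (Nat.eqb m 0); [lra|]. destruct (Rlt_dec N (INR m)); [|lra].
    apply Cnorm2_nonneg.
  - intros M. apply Rle_trans with (sum_f_R0 (fun m => exp (- mu) ^ m * G) M).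
    + apply sum_Rle. intros m _.
      assert (0 <= exp (- mu) ^ m * G) by (apply Rmult_le_pos; auto; apply pow_le; lra).
      destruct (Nat.eqb_spec m 0); auto.
      destruct (Rlt_dec N (INR m)) as [HNm|]; auto.
      assert (Hm2 : (2 <= m)%nat).
      { apply INR_lt. simpl. lra. }
      eapply Rle_trans; [apply Hb; auto|].
      unfold Rsqr, G. rewrite minus_INR by lia. rewrite <- exp_mult_INR.
      replace (C * exp (- mu * (INR m - INR 1 - b)) * (C * exp (- mu * (INR m - INR 1 - b))))
        with (C * C * (exp (- mu * (INR m - INR 1 - b)) * exp (- mu * (INR m - INR 1 - b))))
        by ring.
      rewrite <- exp_plus.
      replace (exp (- mu * INR m) * (C * C * exp (mu * 2 * b + 2 * mu - mu * N))) with
        (C * C * (exp (- mu * INR m) * exp (mu * 2 * b + 2 * mu - mu * N))) by ring.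
      rewrite <- exp_plus. apply Rmult_le_compat_l; [nra|].
      destruct (Rle_lt_or_eq_dec
        (- mu * (INR m - INR 1 - b) + - mu * (INR m - INR 1 - b))
        (- mu * INR m + (mu * 2 * b + 2 * mu - mu * N))) as [Hlt|Heq].
      * simpl. nra.
      * left; apply exp_increasing; auto.
      * rewrite Heq; lra.
    + rewrite <- scal_sum. unfold G at 1.
      apply Rmult_le_compat_l; auto. apply geometric_sum_le; auto.
Qed.

Lemma no_transport_beyond lam om alpha beta : 0 < lam ->
  (forall n, exists E psi, eigenbasis (Vfib lam om) n E psi) ->
  LR lam om alpha -> 0 < beta -> Splus_finite lam om beta -> beta <= alpha.
Proof.
  intros Hl Hex HLR Hb [K HS]. apply Rnot_lt_le. intros Hab.
  destruct (LR_one_particle _ _ _ HLR) as (C & mu & v & HC & Hmu & Hv & Hwave).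
  (* The half-line time [t] corresponds to the spin-chain time [t / 2], whose power is
     [Rpower 2 (- alpha) * Rpower t alpha]. *)
  set (v' := v * Rpower 2 (- alpha)).
  assert (Hv' : 0 <= v') by (unfold v'; apply Rmult_le_pos; auto; left; apply exp_pos).
  set (D := C * C * / (1 - exp (- mu))).
  assert (He1 : exp (- mu) < 1) by (rewrite <- exp_0; apply exp_increasing; lra).
  assert (HD : 0 < D).
  { unfold D. apply Rmult_lt_0_compat; [nra|]. apply Rinv_0_lt_compat; lra. }
  (* A positive exponent in [[alpha, beta)]: even for [alpha <= 0], the power [t^g] dominates the
     constants, the logarithm and [t^alpha]. *)
  set (g := Rmax alpha (beta / 2)).
  assert (Hg : 0 < g /\ g < beta /\ alpha <= g).
  { unfold g. pose proof (Rmax_l alpha (beta / 2)). pose proof (Rmax_r alpha (beta / 2)).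
    repeat split; auto; [lra|]. apply Rmax_lub_lt; lra. }
  (* After taking logarithms, [mu * c] collects the coefficients of [t^g]. The choice of [T] then
     gives [t^(beta - g) > c], the contradiction, and [t^beta > 2], so that [N = t^beta - 1] is at
     least [1]. *)
  set (c := (Rabs K / g + Rabs (ln D) + 2 * mu * v' + 3 * mu) / mu).
  set (T := exp (Rmax (c / (beta - g)) (2 / beta))).
  destruct (HS T) as (t & HTt & Ht1 & HP & HK).
  assert (HL : Rmax (c / (beta - g)) (2 / beta) < ln t).
  { rewrite <- (ln_exp (Rmax _ _)). apply ln_increasing; auto. apply exp_pos. }
  pose proof (Rmax_l (c / (beta - g)) (2 / beta)) as M1.
  pose proof (Rmax_r (c / (beta - g)) (2 / beta)) as M2.
  set (L := ln t) in *.
  assert (HLpos : 0 < L) by (unfold L; rewrite <- ln_1; apply ln_increasing; lra).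
  assert (Epow : forall y, Rpower t y = exp (y * L)) by reflexivity.
  assert (HtN : 2 < Rpower t beta).
  { rewrite Epow. assert (2 < beta * L).
    { apply (Rmult_lt_reg_r (/ beta)); [apply Rinv_0_lt_compat; auto|].
      replace (beta * L * / beta) with L by (field; lra). unfold Rdiv in M2. lra. }
    pose proof (exp_ineq1_le (beta * L)). lra. }
  assert (HPb : Pout lam om (Rpower t beta - 1) t <=
    D * exp (mu * 2 * (v' * Rpower t alpha) + 3 * mu - mu * Rpower t beta)).
  { eapply Rle_trans; [apply (Pout_bound lam om t _ C mu (v' * Rpower t alpha)); auto; [lra|]|].
    - intros m Hm.
      apply (amp_bound lam om t m); auto; try lra; try lia.
      + left. apply Rmult_lt_0_compat; auto. apply exp_pos.
      + intros n E psi basis Hmn. destruct m as [|m]; [lia|].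
        pose proof (Hwave n E psi 0%nat m (t / 2) basis ltac:(lia) ltac:(lia) ltac:(lra)) as H.
        replace (2 * (t / 2)) with t in H by field.
        replace (v' * Rpower t alpha) with (v * Rpower (t / 2) alpha).
        * replace (S m - 1)%nat with (m - 0)%nat by lia. exact H.
        * unfold v'. rewrite Rmult_assoc. f_equal. unfold Rdiv.
          rewrite <- Rpower_mult_distr, Rmult_comm by lra. f_equal.
          unfold Rpower. rewrite ln_Rinv by lra. f_equal; ring.
    - right. unfold D.
      replace (mu * 2 * (v' * Rpower t alpha) + 2 * mu - mu * (Rpower t beta - 1))
        with (mu * 2 * (v' * Rpower t alpha) + 3 * mu - mu * Rpower t beta) by ring.
      ring. }
  assert (Hln : - K * L <= ln D + (mu * 2 * (v' * Rpower t alpha) + 3 * mu - mu * Rpower t beta)).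
  { apply Rle_trans with (ln (Pout lam om (Rpower t beta - 1) t)).
    - apply (Rmult_le_compat_r L) in HK; [|lra].
      unfold Rdiv in HK. rewrite Rmult_assoc, Rinv_l, Rmult_1_r in HK by lra. exact HK.
    - rewrite <- (ln_exp (mu * 2 * _ + _ - _)), <- ln_mult; auto; [|apply exp_pos].
      destruct HPb as [Hlt| ->]; [left; apply ln_increasing; auto|lra]. }
  rewrite !Epow in Hln.
  assert (Gg : 1 <= exp (g * L)) by
    (pose proof (exp_ineq1_le (g * L)); nra).
  assert (Ga : exp (alpha * L) <= exp (g * L)).
  { destruct (Req_dec alpha g) as [e|]; [rewrite e; lra|]. left; apply exp_increasing. nra. }
  assert (GL : K * L <= Rabs K / g * exp (g * L)).
  { pose proof (exp_ineq1_le (g * L)). pose proof (Rle_abs K). pose proof (Rabs_pos K).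
    apply Rle_trans with (Rabs K * L); [nra|].
    apply (Rmult_le_reg_r g); [lra|].
    replace (Rabs K / g * exp (g * L) * g) with (Rabs K * exp (g * L)) by (field; lra).
    nra. }
  assert (Gb : exp (beta * L) = exp (g * L) * exp ((beta - g) * L)).
  { rewrite <- exp_plus. f_equal; ring. }
  assert (GD : ln D <= Rabs (ln D) * exp (g * L)).
  { pose proof (Rle_abs (ln D)). pose proof (Rabs_pos (ln D)). nra. }
  assert (F : mu * exp (beta * L) <= mu * c * exp (g * L)).
  { assert (Ec : mu * c = Rabs K / g + Rabs (ln D) + 2 * mu * v' + 3 * mu)
      by (unfold c; field; lra).
    rewrite Ec. assert (mu * v' * exp (alpha * L) <= mu * v' * exp (g * L)).
    { apply Rmult_le_compat_l; auto. nra. }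
    nra. }
  rewrite Gb in F.
  assert (F2 : exp ((beta - g) * L) <= c).
  { apply (Rmult_le_reg_l (mu * exp (g * L))); [nra|]. nra. }
  pose proof (exp_ineq1_le ((beta - g) * L)).
  assert (c < (beta - g) * L).
  { apply (Rmult_lt_reg_r (/ (beta - g))); [apply Rinv_0_lt_compat; lra|].
    replace ((beta - g) * L * / (beta - g)) with L by (field; lra). unfold Rdiv in M1. lra. }
  lra.
Qed.

(** * Cubes exclude uniform localization *)

Lemma derivable_pt_lim_Rsum n (f f' : nat -> R -> R) t :
  (forall k, (k < n)%nat -> derivable_pt_lim (f k) t (f' k t)) ->
  derivable_pt_lim (fun s => Rsum n (fun k => f k s)) t (Rsum n (fun k => f' k t)).
Proof.
  induction n; simpl; intros H; [apply derivable_pt_lim_const|].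
  apply (derivable_pt_lim_plus (fun s => Rsum n (fun k => f k s)) (f n)); auto.
Qed.

Lemma Rsum_Rabs n f : Rabs (Rsum n f) <= Rsum n (fun k => Rabs (f k)).
Proof.
  induction n; simpl; [rewrite Rabs_R0; lra|].
  eapply Rle_trans; [apply Rabs_triang|]. lra.
Qed.

(** The time average of [|sum_k w_k e^{i t E_k}|^2] is [sum_k w_k^2] when the
    energies are distinct; the average is taken through an explicit primitive. *)
Lemma time_average n E w T0 B :
  (forall k l, (k < n)%nat -> (l < n)%nat -> E k = E l -> k = l) ->
  (forall t, T0 <= t -> Cnorm2 (wave n E w t) <= B) ->
  Rsum n (fun k => w k * w k) <= B.
Proof.
  intros Hinj HB. set (S0 := Rsum n (fun k => w k * w k)).
  (* Primitives of [cos (t * (E k - E l))]; the diagonal ones grow linearly and the others stay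
     bounded. *)
  set (G := fun k l t => if Nat.eqb k l then t else sin (t * (E k - E l)) / (E k - E l)).
  set (F := fun t => Rsum n (fun k => Rsum n (fun l => w k * w l * G k l t))).
  assert (HF : forall t, derivable_pt_lim F t (Cnorm2 (wave n E w t))).
  { intros t. rewrite wave_norm2. unfold F.
    apply (derivable_pt_lim_Rsum n (fun k s => Rsum n (fun l => w k * w l * G k l s))
      (fun k s => Rsum n (fun l => w k * w l * cos (s * (E k - E l))))). intros k Hk.
    apply (derivable_pt_lim_Rsum n (fun l s => w k * w l * G k l s)
      (fun l s => w k * w l * cos (s * (E k - E l)))). intros l Hl.
    apply (derivable_pt_lim_scal (G k l)). unfold G.
    destruct (Nat.eqb_spec k l) as [->|ne].
    - replace (t * (E l - E l)) with 0 by ring. rewrite cos_0. apply derivable_pt_lim_id.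
    - assert (D : E k - E l <> 0) by (intros D; apply ne, Hinj; auto; lra).
      replace (cos (t * (E k - E l))) with
        (cos (t * (E k - E l)) * (E k - E l) * / (E k - E l) +
         sin (t * (E k - E l)) * 0) by (field; auto).
      apply (derivable_pt_lim_mult (fun s => sin (s * (E k - E l))) (fct_cte (/ (E k - E l))));
        [|apply derivable_pt_lim_const].
      apply (derivable_pt_lim_comp (fun s => s * (E k - E l)) sin);
        [|apply derivable_pt_lim_sin].
      generalize (E k - E l). intros y.
      pose proof (derivable_pt_lim_mult id (fct_cte y) t 1 0
        (derivable_pt_lim_id t) (derivable_pt_lim_const y t)) as Hm.
      replace (1 * fct_cte y t + id t * 0) with y in Hm by (unfold fct_cte; ring).
      exact Hm. }
  set (Q := Rsum n (fun k => Rsum n (fun l => Rabs (w k * w l) *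
      if Nat.eqb k l then 0 else Rabs (/ (E k - E l))))).
  assert (HQ : forall t, Rabs (F t - t * S0) <= Q).
  { intros t. assert (ES : t * S0 = Rsum n (fun k => Rsum n (fun l =>
        w k * w l * if Nat.eqb k l then t else 0))).
    { unfold S0. rewrite <- Rsum_scal. apply Rsum_ext; intros k Hk.
      rewrite (Rsum_single _ _ k); auto.
      - rewrite Nat.eqb_refl; ring.
      - intros l _ ne. rewrite (proj2 (Nat.eqb_neq k l)) by auto. ring. }
    rewrite ES. unfold F. rewrite <- Rsum_minus.
    eapply Rle_trans; [apply Rsum_Rabs|]. apply Rsum_le; intros k _.
    rewrite <- Rsum_minus.
    eapply Rle_trans; [apply Rsum_Rabs|]. apply Rsum_le; intros l _.
    unfold G. destruct (Nat.eqb k l).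
    - replace (_ - _) with 0 by ring. rewrite Rabs_R0. lra.
    - rewrite Rmult_0_r, Rminus_0_r. replace (_ * _) with (w k * w l * (sin (t * (E k - E l)) * / (E k - E l)))
        by (unfold Rdiv; ring).
      rewrite Rabs_mult. apply Rmult_le_compat_l; [apply Rabs_pos|].
      rewrite Rabs_mult.
      rewrite <- (Rmult_1_l (Rabs (/ (E k - E l)))) at 2.
      apply Rmult_le_compat_r; [apply Rabs_pos|].
      apply Rabs_le. apply SIN_bound. }
  assert (HQ0 : 0 <= Q) by (eapply Rle_trans; [apply Rabs_pos|apply (HQ 0)]).
  apply Rnot_lt_le. intros HSB.
  (* By the mean value theorem [F] grows by at most [B * (T - T0)], while it equals [T * S0] up to
     [Q]. This [T] is large enough to make the two incompatible when [B < S0]. *)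
  set (c := Rabs T0 * (Rabs S0 + Rabs B) + 2 * Q + 1).
  set (T := Rabs T0 + 1 + c / (S0 - B)).
  assert (Hc : 0 < c).
  { unfold c. pose proof (Rabs_pos T0). pose proof (Rabs_pos S0). pose proof (Rabs_pos B). nra. }
  assert (HcS : 0 < c / (S0 - B)) by (apply Rmult_lt_0_compat; auto; apply Rinv_0_lt_compat; lra).
  assert (HT : T0 < T) by (unfold T; pose proof (Rle_abs T0); lra).
  destruct (MVT_cor2 F (fun t => Cnorm2 (wave n E w t)) T0 T HT) as (x & Hx & Hx2);
    [intros; apply HF|].
  pose proof (HB x ltac:(lra)) as HBx.
  assert (H1 : F T - F T0 <= B * (T - T0)).
  { rewrite Hx. apply Rmult_le_compat_r; lra. }
  pose proof (HQ T) as QT. pose proof (HQ T0) as QT0.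
  pose proof (Rle_abs (F T0 - T0 * S0)). pose proof (Rle_abs (- (F T - T * S0))) as QT'.
  rewrite Rabs_Ropp in QT'.
  assert (H2 : T * (S0 - B) <= 2 * Q + T0 * (S0 - B)) by nra.
  assert (H3 : T * (S0 - B) = (Rabs T0 + 1) * (S0 - B) + c).
  { unfold T. field; lra. }
  pose proof (Rle_abs T0). pose proof (Rle_abs S0). pose proof (Rle_abs (- B)) as HB'.
  rewrite Rabs_Ropp in HB'. pose proof (Rabs_pos T0).
  assert (T0 * (S0 - B) <= Rabs T0 * (Rabs S0 + Rabs B)) by nra.
  unfold c in H3. nra.
Qed.

(** The coefficients are chosen before [v], so one unimodular matrix serves every window with the
    same potential. *)
Lemma transfer_matrix (e : R) (U : nat -> R) q : exists a b c d : R, a * d - b * c = 1 /\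
  forall v : nat -> R,
    (forall s, (s < q)%nat -> v (S (S s)) + v s + U s * v (S s) = e * v (S s)) ->
    v q = a * v 0%nat + b * v 1%nat /\ v (S q) = c * v 0%nat + d * v 1%nat.
Proof.
  induction q as [|q (a & b & c & d & Hdet & IH)].
  - exists 1, 0, 0, 1. split; [ring|]. intros; split; ring.
  - exists c, d, ((e - U q) * c - a), ((e - U q) * d - b). split; [nra|].
    intros v Hv. destruct (IH v) as [E1 E2]; [intros; apply Hv; lia|].
    split; auto. pose proof (Hv q ltac:(lia)) as H.
    replace (v (S (S q))) with ((e - U q) * v (S q) - v q) by lra.
    rewrite E1, E2. ring.
Qed.

(** Gordon's argument: the transfer matrix [M] over one period satisfies
    [M^2 - tr M * M + 1 = 0]; use it backwards if [|tr M| <= 1] and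
    divide by [tr M] otherwise. *)
Lemma gordon (V u : nat -> R) e i q :
  (forall m, (i <= m)%nat -> (m < i + 3 * q)%nat ->
     u (S (S m)) + u m + V (S m) * u (S m) = e * u (S m)) ->
  (forall m, (i < m)%nat -> (m <= i + 2 * q)%nat -> V (m + q)%nat = V m) ->
  Rsqr (u (i + q)%nat) <=
  2 * (Rsqr (u i) + Rsqr (u (i + 2 * q)%nat) + Rsqr (u (i + 3 * q)%nat)).
Proof.
  intros Hu HV.
  destruct (transfer_matrix e (fun s => V (S (i + s))) q) as (a & b & c & d & Hdet & HM).
  assert (St : forall r, (r <= 2)%nat ->
    u (i + r * q + q)%nat = a * u (i + r * q)%nat + b * u (S (i + r * q)) /\
    u (S (i + r * q + q)) = c * u (i + r * q)%nat + d * u (S (i + r * q))).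
  { intros r Hr. destruct (HM (fun s => u (i + r * q + s)%nat)) as [E1 E2].
    - intros s Hs. rewrite !Nat.add_succ_r.
      rewrite <- (Hu (i + r * q + s)%nat) by nia. f_equal. f_equal.
      (* Periodicity carries the second and third blocks back to the first, so all three share one
         transfer matrix. *)
      assert (P : forall k, (k <= 2)%nat -> V (S (i + k * q + s)) = V (S (i + s))).
      { induction k; intros Hk; [f_equal; lia|].
        rewrite <- IHk by lia. rewrite <- (HV (S (i + k * q + s))) by nia. f_equal; lia. }
      rewrite P by lia. reflexivity.
    - rewrite Nat.add_0_r in *. rewrite Nat.add_1_r in *. rewrite Nat.add_succ_r in E2. auto. }
  destruct (St 0%nat) as [A0 B0]; [lia|]. destruct (St 1%nat) as [A1 B1]; [lia|].
  destruct (St 2%nat) as [A2 B2]; [lia|].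
  replace (i + 0 * q)%nat with i in * by lia.
  replace (i + 1 * q)%nat with (i + q)%nat in * by lia.
  replace (i + q + q)%nat with (i + 2 * q)%nat in * by lia.
  replace (i + 2 * q + q)%nat with (i + 3 * q)%nat in * by lia.
  set (x0 := u i) in *. set (x1 := u (i + q)%nat) in *.
  set (x2 := u (i + 2 * q)%nat) in *. set (x3 := u (i + 3 * q)%nat) in *.
  set (y0 := u (S i)) in *. set (y1 := u (S (i + q))) in *. set (y2 := u (S (i + 2 * q))) in *.
  (* First component of [M^2 + 1 = tr M M] applied at [i], and likewise at [i + q] for [C2]. *)
  assert (C1 : x2 + x0 = (a + d) * x1).
  { rewrite A1, B0. replace x0 with ((a * d - b * c) * x0) at 2 by (rewrite Hdet; ring).
    transitivity (a * x1 + d * (a * x0 + b * y0)); [ring|]. rewrite <- A0. ring. }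
  assert (C2 : x3 + x1 = (a + d) * x2).
  { rewrite A2, B1. replace x1 with ((a * d - b * c) * x1) at 2 by (rewrite Hdet; ring).
    transitivity (a * x2 + d * (a * x1 + b * y1)); [ring|]. rewrite <- A1. ring. }
  unfold Rsqr. generalize (a + d) C1 C2. intros tr D1 D2.
  destruct (Rle_dec (tr * tr) 1) as [H|H].
  - assert (x1 = tr * x2 - x3) by lra. subst x1.
    assert (tr * tr * (x2 * x2) <= 1 * (x2 * x2)) by (apply Rmult_le_compat_r; nra).
    pose proof (Rle_0_sqr (tr * x2 + x3)). pose proof (Rle_0_sqr x0). unfold Rsqr in *. nra.
  - assert (1 * (x1 * x1) <= tr * tr * (x1 * x1)) by (apply Rmult_le_compat_r; nra).
    assert (tr * tr * (x1 * x1) = (x2 + x0) * (x2 + x0)) by (rewrite D1; ring).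
    pose proof (Rle_0_sqr (x2 - x0)). pose proof (Rle_0_sqr x3). unfold Rsqr in *. nra.
Qed.

(** Lagrange's identity: the defect is half of a double sum of squares. *)
Lemma Rsum_cauchy_schwarz n x y :
  Rsqr (Rsum n (fun k => x k * y k)) <=
  Rsum n (fun k => x k * x k) * Rsum n (fun k => y k * y k).
Proof.
  assert (H : 0 <= Rsum n (fun k => Rsum n (fun l => Rsqr (x k * y l - x l * y k)))).
  { apply Rsum_nonneg; intros; apply Rsum_nonneg; intros; apply Rle_0_sqr. }
  assert (E : Rsum n (fun k => Rsum n (fun l => Rsqr (x k * y l - x l * y k))) =
    Rsum n (fun k => x k * x k) * Rsum n (fun k => y k * y k) +
    Rsum n (fun k => y k * y k) * Rsum n (fun k => x k * x k) -
    2 * (Rsum n (fun k => x k * y k) * Rsum n (fun k => x k * y k))).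
  { rewrite !Rsum_mult, <- Rsum_scal, <- Rsum_plus, <- Rsum_minus.
    apply Rsum_ext; intros.
    rewrite <- Rsum_scal, <- Rsum_plus, <- Rsum_minus. apply Rsum_ext; intros.
    unfold Rsqr; ring. }
  unfold Rsqr at 1. lra.
Qed.

Definition dist (m j : nat) : nat := (m - j) + (j - m).

Lemma two_sided_geometric r j n : 0 <= r < 1 ->
  Rsum n (fun m => r ^ dist m j) * (1 - r) <= 2.
Proof.
  intros Hr.
  (* After multiplication by [1 - r] the sum telescopes on each side of [j]; the sharper bounds
     carry the induction. *)
  assert (G : ((n <= S j)%nat -> Rsum n (fun m => r ^ dist m j) * (1 - r) <= r ^ (S j - n)) /\
     ((S j <= n)%nat -> Rsum n (fun m => r ^ dist m j) * (1 - r) <= 2 - r ^ (n - j))).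
  { induction n as [|n [IH1 IH2]].
    - split; intros; [|lia]. simpl Rsum. rewrite Rmult_0_l. apply pow_le; lra.
    - assert (L : (S n <= S j)%nat ->
         Rsum (S n) (fun m => r ^ dist m j) * (1 - r) <= r ^ (S j - S n)).
      { intros Hn. specialize (IH1 ltac:(lia)). cbn [Rsum].
        replace (dist n j) with (S j - S n)%nat by (unfold dist; lia).
        replace (S j - n)%nat with (S (S j - S n)) in IH1 by lia. rewrite <- tech_pow_Rmult in IH1. lra. }
      split; auto. intros Hn. destruct (Nat.eq_dec n j) as [->|ne].
      + specialize (L ltac:(lia)). replace (S j - S j)%nat with 0%nat in L by lia.
        replace (S j - j)%nat with 1%nat by lia. simpl pow in *. lra.
      + specialize (IH2 ltac:(lia)). cbn [Rsum].
        replace (dist n j) with (n - j)%nat by (unfold dist; lia).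
        replace (S n - j)%nat with (S (n - j)) by lia. rewrite <- tech_pow_Rmult. lra. }
  destruct (Nat.le_ge_cases n (S j)) as [H|H].
  - pose proof (proj1 G H) as G1. assert (r ^ (S j - n) <= 1); [|lra].
    rewrite <- (pow1 (S j - n)). apply pow_incr; lra.
  - pose proof (proj2 G H) as G2. pose proof (pow_le r (n - j) (proj1 Hr)). lra.
Qed.

(** Averaging over time, localization bounds the overlaps
    [a_m = sum_k psi_k(J)^2 psi_k(m)^2] by [(K r^|m-J|)^2].  Their sum is [1] and
    [a_m^2 <= a_J], so [a_J] is bounded below; Gordon's estimate bounds it above
    by overlaps at distance at least [q]. *)
Lemma cubes_delocalize V K mu :
  (forall n, exists E psi, eigenbasis V n E psi) ->
  (forall Q, exists i q, (Q <= q)%nat /\ (1 <= q)%nat /\ (1 <= i)%nat /\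
     forall m, (i < m)%nat -> (m <= i + 2 * q)%nat -> V (m + q)%nat = V m) ->
  0 < mu ->
  (forall n E psi j m t, eigenbasis V n E psi -> (j < m)%nat -> (m < n)%nat -> 2 <= t ->
     sqrt (Cnorm2 (wave n E (fun k => psi k (S j) * psi k (S m)) t)) <=
     K * exp (- mu * INR (m - j))) ->
  False.
Proof.
  intros Hex Hcube Hmu Hloc.
  set (r := exp (- mu)).
  assert (Hr : 0 < r < 1).
  { split; [apply exp_pos|]. unfold r. rewrite <- exp_0. apply exp_increasing; lra. }
  set (K1 := Rmax K 1).
  assert (HK1 : K <= K1 /\ 1 <= K1) by (split; [apply Rmax_l|apply Rmax_r]).
  set (c := 2 * K1 / (1 - r)).
  assert (Hc : 0 < c) by (apply Rmult_lt_0_compat; [lra|apply Rinv_0_lt_compat; lra]).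
  (* The lower bound [1 <= s c^4] and the upper bound [s <= 6 K1^2 r^q] on the overlap [s] give
     [1 <= A r^q], which fails for large [q]. *)
  set (A := 6 * (K1 * K1) * (c * c * (c * c))).
  assert (HA : 0 < A) by (unfold A; assert (0 < c * c) by (apply Rmult_lt_0_compat; auto);
    apply Rmult_lt_0_compat; [nra|apply Rmult_lt_0_compat; auto]).
  destruct (pow_lt_1_zero r) with (y := / A) as [Q HQ];
    [rewrite Rabs_right; lra|apply Rinv_0_lt_compat; auto|].
  destruct (Hcube Q) as (i & q & HqQ & Hq & Hi & HV).
  specialize (HQ q HqQ). rewrite Rabs_right in HQ by (apply Rle_ge, pow_le; lra).
  (* The chain ends with the cube. The index [j] below counts from [0] and denotes the site [i + q]
     at which Gordon's estimate applies. *)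
  set (n := (i + 3 * q)%nat). destruct (Hex n) as (E & psi & basis).
  set (j := (i + q - 1)%nat). assert (Hj : (j < n)%nat) by (unfold j, n; lia).
  set (a := fun m => Rsum n (fun k => Rsqr (psi k (S j)) * Rsqr (psi k (S m)))).
  assert (Hsq1 : forall k m, (k < n)%nat -> (m < n)%nat -> Rsqr (psi k (S m)) <= 1).
  { intros k m Hk Hm.
    pose proof (eb_complete _ _ _ _ basis m m Hm Hm) as H. rewrite Nat.eqb_refl in H.
    rewrite <- H. apply (Rsum_term_le n (fun k => psi k (S m) * psi k (S m))); auto.
    intros; apply Rle_0_sqr. }
  assert (Hcol : forall m, (m < n)%nat -> Rsum n (fun k => Rsqr (psi k (S m))) = 1).
  { intros m Hm. pose proof (eb_complete _ _ _ _ basis m m Hm Hm) as H.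
    rewrite Nat.eqb_refl in H. exact H. }
  assert (Ha0 : forall m, 0 <= a m).
  { intros m. apply Rsum_nonneg; intros. apply Rmult_le_pos; apply Rle_0_sqr. }
  assert (Hoff : forall j m, (j < m)%nat -> (m < n)%nat ->
     Rsum n (fun k => Rsqr (psi k (S j)) * Rsqr (psi k (S m))) <= Rsqr (K1 * r ^ (m - j))).
  { intros j0 m Hjm Hm.
    rewrite (Rsum_ext _ _ (fun k => (psi k (S j0) * psi k (S m)) * (psi k (S j0) * psi k (S m))))
      by (intros; unfold Rsqr; ring).
    apply (time_average n E (fun k => psi k (S j0) * psi k (S m)) 2).
    - intros; eapply (eb_inj _ _ _ _ basis); eauto.
    - intros t Ht. pose proof (Hloc n E psi j0 m t basis Hjm Hm Ht) as H.
      unfold r. rewrite <- exp_mult_INR.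
      rewrite <- (sqrt_sqrt (Cnorm2 _)) by apply Cnorm2_nonneg.
      pose proof (sqrt_pos (Cnorm2 (wave n E (fun k => psi k (S j0) * psi k (S m)) t))).
      assert (K * exp (- mu * INR (m - j0)) <= K1 * exp (- mu * INR (m - j0))).
      { apply Rmult_le_compat_r; [left; apply exp_pos|lra]. }
      apply Rmult_le_compat; lra. }
  assert (Ha : forall m, (m < n)%nat -> a m <= Rsqr (K1 * r ^ dist m j)).
  { intros m Hm. unfold a, dist. destruct (lt_eq_lt_dec m j) as [[H|H]|H].
    - replace (m - j + (j - m))%nat with (j - m)%nat by lia.
      rewrite (Rsum_ext _ _ (fun k => Rsqr (psi k (S m)) * Rsqr (psi k (S j))))
        by (intros; ring). apply Hoff; lia.
    - rewrite H, !Nat.sub_diag. simpl. rewrite Rmult_1_r.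
      apply Rle_trans with 1; [|unfold Rsqr; nra].
      rewrite <- (Hcol j Hj). apply Rsum_le; intros k Hk.
      pose proof (Hsq1 k j Hk Hj). pose proof (Rle_0_sqr (psi k (S j))). nra.
    - replace (m - j + (j - m))%nat with (m - j)%nat by lia. apply Hoff; lia. }
  assert (Hsum : Rsum n a = 1).
  { unfold a. rewrite Rsum_swap. rewrite <- (Hcol j Hj). apply Rsum_ext; intros k Hk.
    rewrite Rsum_scal. replace (Rsum n _) with 1; [ring|].
    symmetry; apply (eb_norm _ _ _ _ basis k Hk). }
  (* [sg] is the fourth root of [s]. The bounds [a m <= sg^2] and [a m <= (K1 r^dist)^2] have the
     summable geometric mean [sg K1 r^dist]. *)
  set (s := a j). set (sg := sqrt (sqrt s)).
  assert (Hsg : 0 <= sg /\ sg * sg = sqrt s /\ sqrt s * sqrt s = s).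
  { unfold sg. repeat split; [apply sqrt_pos|apply sqrt_sqrt, sqrt_pos|apply sqrt_sqrt, Ha0]. }
  destruct Hsg as (Hsg0 & Hsg1 & Hsg2).
  assert (Has : forall m, (m < n)%nat -> a m <= sg * sg).
  { intros m Hm. rewrite Hsg1. apply Rsqr_incr_0_var; [|apply sqrt_pos].
    unfold Rsqr at 2. rewrite Hsg2. unfold s, a.
    eapply Rle_trans; [apply Rsum_cauchy_schwarz|].
    eapply Rle_trans; [|right; apply Rmult_1_r].
    apply Rmult_le_compat_l; [apply Ha0|].
    rewrite <- (Hcol m Hm). apply Rsum_le; intros k Hk.
    pose proof (Hsq1 k m Hk Hm). pose proof (Rle_0_sqr (psi k (S m))). nra. }
  assert (Has2 : forall m, (m < n)%nat -> a m <= sg * K1 * r ^ dist m j).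
  { intros m Hm. pose proof (pow_le r (dist m j) ltac:(lra)).
    apply Rsqr_incr_0_var; [|apply Rmult_le_pos; auto; apply Rmult_le_pos; lra].
    pose proof (Ha m Hm). pose proof (Has m Hm). pose proof (Ha0 m).
    unfold Rsqr in *.
    apply Rle_trans with (sg * sg * (K1 * r ^ dist m j * (K1 * r ^ dist m j))); [|right; ring].
    apply Rmult_le_compat; auto. }
  assert (Hlow : 1 <= sg * c).
  { rewrite <- Hsum. apply Rle_trans with (Rsum n (fun m => sg * K1 * r ^ dist m j)).
    - apply Rsum_le; auto.
    - rewrite Rsum_scal. pose proof (two_sided_geometric r j n ltac:(lra)) as G.
      unfold c. apply (Rmult_le_reg_r (1 - r)); [lra|].
      replace (sg * (2 * K1 / (1 - r)) * (1 - r)) with (sg * K1 * 2) by (field; lra).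
      rewrite Rmult_assoc. apply Rmult_le_compat_l; [apply Rmult_le_pos; lra|lra]. }
  (* Gordon's estimate for each eigenfunction, weighted by its squared value at [j] and summed; the
     energy has disappeared from it. *)
  assert (Hgor : s <= 2 * (a (i - 1)%nat + a (i + 2 * q - 1)%nat + a (i + 3 * q - 1)%nat)).
  { unfold s, a. rewrite <- !Rsum_plus, <- Rsum_scal. apply Rsum_le; intros k Hk.
    assert (Hg : Rsqr (psi k (S j)) <= 2 * (Rsqr (psi k (S (i - 1))) +
       Rsqr (psi k (S (i + 2 * q - 1))) + Rsqr (psi k (S (i + 3 * q - 1))))).
    { unfold j. replace (S (i + q - 1)) with (i + q)%nat by lia.
      replace (S (i - 1)) with i by lia.
      replace (S (i + 2 * q - 1)) with (i + 2 * q)%nat by lia.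
      replace (S (i + 3 * q - 1)) with (i + 3 * q)%nat by lia.
      apply (gordon V (psi k) (E k)); auto.
      intros m Hm1 Hm2. apply (eb_rec _ _ _ _ basis); auto. }
    pose proof (Rle_0_sqr (psi k (S j))). nra. }
  assert (Hfar : forall m, (m < n)%nat -> (q <= dist m j)%nat -> a m <= K1 * K1 * r ^ q).
  { intros m Hm Hd. eapply Rle_trans; [apply Ha; auto|]. unfold Rsqr.
    assert (P : 0 <= r ^ dist m j <= r ^ q).
    { split; [apply pow_le; lra|].
      replace (dist m j) with (q + (dist m j - q))%nat by lia. rewrite pow_add.
      pose proof (pow_le r q ltac:(lra)).
      assert (r ^ (dist m j - q) <= 1) by (rewrite <- (pow1 (dist m j - q)); apply pow_incr; lra).
      nra. }
    assert (P1 : r ^ q <= 1) by (rewrite <- (pow1 q); apply pow_incr; lra).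
    assert (r ^ dist m j * r ^ dist m j <= r ^ q) by nra.
    assert (0 <= K1 * K1) by nra. nra. }
  assert (Hup : s <= 6 * (K1 * K1) * r ^ q).
  { pose proof (Hfar (i - 1)%nat ltac:(unfold n; lia) ltac:(unfold dist, j; lia)).
    pose proof (Hfar (i + 2 * q - 1)%nat ltac:(unfold n; lia) ltac:(unfold dist, j; lia)).
    pose proof (Hfar (i + 3 * q - 1)%nat ltac:(unfold n; lia) ltac:(unfold dist, j; lia)).
    lra. }
  assert (H1 : 1 <= s * (c * c * (c * c))).
  { rewrite <- Hsg2, <- Hsg1.
    replace (sg * sg * (sg * sg) * (c * c * (c * c))) with
      ((sg * c) * (sg * c) * ((sg * c) * (sg * c))) by ring.
    assert (1 <= sg * c * (sg * c)) by nra. nra. }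
  assert (H2 : 1 <= A * r ^ q).
  { eapply Rle_trans; [exact H1|]. unfold A.
    replace (6 * (K1 * K1) * (c * c * (c * c)) * r ^ q) with
      (6 * (K1 * K1) * r ^ q * (c * c * (c * c))) by ring.
    apply Rmult_le_compat_r; auto. assert (0 <= c * c) by nra. nra. }
  apply (Rmult_lt_compat_l A) in HQ; auto. rewrite Rinv_r in HQ by lra. lra.
Qed.

(** * Cubes in the Fibonacci potential *)

Lemma inv_phi_spec : 0 < / phi < 1 /\ / phi * / phi = 1 - / phi.
Proof.
  assert (H5 : sqrt 5 * sqrt 5 = 5) by (apply sqrt_sqrt; lra).
  assert (H : 2 < sqrt 5) by (rewrite <- (sqrt_Rsqr 2) by lra; apply sqrt_lt_1_alt; unfold Rsqr; lra).
  assert (E : / phi = (sqrt 5 - 1) / 2).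
  { apply (Rmult_eq_reg_l phi); [|unfold phi; lra].
    rewrite Rinv_r by (unfold phi; lra). unfold phi. nra. }
  rewrite E. split; [split|]; nra.
Qed.

Lemma frac_unique x z : 0 <= x - IZR z < 1 -> frac x = x - IZR z.
Proof. intros H. unfold frac. rewrite <- (Int_part_spec x z); [auto|lra]. Qed.

Lemma frac_shift x : exists z, frac x = x - IZR z /\ 0 <= frac x < 1.
Proof.
  exists (Int_part x). unfold frac. split; auto.
  destruct (base_Int_part x). lra.
Qed.

(** Convergents: [q = F_{2l+2}], [q' = F_{2l+3}] with numerators [p], [p']. *)
Lemma convergents (l : nat) : exists q p q' p' : Z,
  (Z.of_nat l + 1 <= q)%Z /\ (q + Z.of_nat l + 1 <= q')%Z /\
  (q * p' + 1 = q' * p)%Z /\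
  IZR q * / phi - IZR p = - (/ phi) ^ (2 * l + 2) /\
  IZR q' * / phi - IZR p' = (/ phi) ^ (2 * l + 3).
Proof.
  destruct inv_phi_spec as [H01 H2].
  induction l as [|l (q & p & q' & p' & Hq & Hq' & Hd & H & H')].
  - exists 1%Z, 1%Z, 2%Z, 1%Z. repeat split; try lia; simpl;
      rewrite Rmult_1_r, H2, ?Rmult_minus_distr_l, ?H2; lra.
  - exists (q + q')%Z, (p + p')%Z, (q + 2 * q')%Z, (p + 2 * p')%Z.
    replace (2 * l + 3)%nat with (1 + (2 * l + 2))%nat in H' by lia.
    rewrite pow_add, pow_1 in H'. set (d := (/ phi) ^ (2 * l + 2)) in *.
    assert (E2 : (/ phi) ^ 2 = 1 - / phi) by (simpl; lra).
    assert (E3 : (/ phi) ^ 3 = 2 * / phi - 1) by (simpl; rewrite Rmult_1_r, H2; lra).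
    repeat split; try lia; try nia.
    + rewrite !plus_IZR.
      replace (2 * S l + 2)%nat with (2 + (2 * l + 2))%nat by lia.
      rewrite pow_add, E2. fold d. lra.
    + rewrite !plus_IZR, !mult_IZR.
      replace (2 * S l + 3)%nat with (3 + (2 * l + 2))%nat by lia.
      rewrite pow_add, E3. fold d. lra.
Qed.

(** Advancing [q'] sites moves the orbit to the right by [d < hi - lo]. Starting to the left of a
    translate of the interval, the orbit cannot jump over it. *)
Lemma rotation_dense om lo hi : 0 <= lo -> lo < hi -> hi <= 1 ->
  exists i, (1 <= i)%nat /\ lo <= frac (INR i * / phi + om) < hi.
Proof.
  intros H0 Hlh H1. destruct inv_phi_spec as [H01 H2].
  destruct (pow_lt_1_zero (/ phi)) with (y := hi - lo) as [l Hl];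
    [rewrite Rabs_right; lra|lra|].
  specialize (Hl (2 * l + 3)%nat ltac:(lia)).
  destruct (convergents l) as (q & p & q' & p' & Hq & Hq' & Hd & H & H').
  set (d := (/ phi) ^ (2 * l + 3)) in *.
  assert (Hd0 : 0 < d) by (apply pow_lt; lra).
  rewrite Rabs_right in Hl by lra.
  set (x0 := / phi + om). set (M := up (x0 - lo)).
  assert (HM : x0 <= lo + IZR M).
  { unfold M. pose proof (archimed (x0 - lo)). lra. }
  set (y := (lo + IZR M - x0) / d).
  assert (Hy : 0 <= y) by (unfold y; apply Rmult_le_pos; [lra|left; apply Rinv_0_lt_compat; auto]).
  destruct (archimed y) as [A1 A2]. set (j := up y) in *.
  assert (Hj : (0 < j)%Z) by (apply lt_IZR; lra).
  assert (Ey : y * d = lo + IZR M - x0) by (unfold y; field; lra).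
  assert (Ei : INR (Z.to_nat (1 + j * q')) = 1 + IZR j * IZR q').
  { rewrite INR_IZR_INZ, Z2Nat.id by nia. rewrite plus_IZR, mult_IZR. auto. }
  exists (Z.to_nat (1 + j * q')). split; [nia|].
  assert (Ex : INR (Z.to_nat (1 + j * q')) * / phi + om - IZR (M + j * p') =
               x0 + IZR j * d - IZR M).
  { rewrite Ei, plus_IZR, mult_IZR. rewrite <- H'. unfold x0. ring. }
  rewrite (frac_unique _ (M + j * p')); rewrite Ex; nra.
Qed.

(** With [q], [q'] consecutive convergents of opposite sign, an orbit point in
    [[d - d', d)] does not come back to [[0, d)] before time [q + q'], the sum of
    the two first return times.  Both discontinuities of the potential lie on
    one orbit, so [V] has period [q] along this stretch of more than [2 q] sites. *)
Lemma Vfib_cubes lam om Q : exists i q, (Q <= q)%nat /\ (1 <= q)%nat /\ (1 <= i)%nat /\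
  forall m, (i < m)%nat -> (m <= i + 2 * q)%nat -> Vfib lam om (m + q) = Vfib lam om m.
Proof.
  destruct inv_phi_spec as [H01 H2].
  destruct (convergents (S Q)) as (q & p & q' & p' & Hq & Hq' & Hd & H & H').
  set (d := (/ phi) ^ (2 * S Q + 2)) in *.
  assert (Ed' : (/ phi) ^ (2 * S Q + 3) = / phi * d).
  { unfold d. replace (2 * S Q + 3)%nat with (S (2 * S Q + 2)) by lia. reflexivity. }
  rewrite Ed' in H'. clear Ed'. set (d' := / phi * d) in *.
  assert (Hd0 : 0 < d) by (apply pow_lt; lra).
  assert (Hd1 : d <= 1) by (unfold d; rewrite <- (pow1 (2 * S Q + 2)); apply pow_incr; lra).
  assert (Hd' : 0 < d' < d) by (unfold d'; nra).
  clearbody d d'.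
  destruct (rotation_dense om (d - d') d) as (i & Hi1 & Hi); try lra.
  assert (Hret : forall s, (1 <= s)%nat -> (Z.of_nat s < q + q')%Z ->
     ~ frac (INR (i + s) * / phi + om) < d).
  { intros s Hs1 Hs2 Hlt.
    destruct (frac_shift (INR i * / phi + om)) as (z & Ez & _).
    destruct (frac_shift (INR (i + s) * / phi + om)) as (z' & Ez' & Hz').
    rewrite Ez in Hi. rewrite Ez' in Hlt, Hz'. clear Ez Ez'. rewrite plus_INR in *.
    rewrite (INR_IZR_INZ s) in *. set (t := Z.of_nat s) in *.
    assert (Ht : (1 <= t)%Z) by (unfold t; lia). clearbody t.
    set (P := (z' - z)%Z).
    assert (EP : IZR z' = IZR z + IZR P) by (unfold P; rewrite minus_IZR; ring).
    rewrite EP in *. clearbody P.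
    (* Coordinates of [(t, P)] in the basis [(q, p)], [(q', p')], integral because its determinant
       is [1]. *)
    set (a := (P * q' - t * p')%Z). set (b := (p * t - q * P)%Z).
    assert (Et : (t = a * q + b * q')%Z)
      by (transitivity (t * (q' * p - q * p'))%Z; [rewrite <- Hd|unfold a, b]; ring).
    assert (EPP : (P = a * p + b * p')%Z)
      by (transitivity (P * (q' * p - q * p'))%Z; [rewrite <- Hd|unfold a, b]; ring).
    assert (Ee : IZR t * / phi - IZR P = - IZR a * d + IZR b * d').
    { rewrite Et, EPP, !plus_IZR, !mult_IZR.
      transitivity (IZR a * (IZR q * / phi - IZR p) + IZR b * (IZR q' * / phi - IZR p')); [ring|].
      rewrite H, H'. ring. }
    clearbody a b. assert (He : - d < - IZR a * d + IZR b * d' < d') by lra.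
    (* If neither coordinate is positive then [t <= 0]; if both are positive then [t >= q + q'];
       mixed signs put the displacement outside [(- d, d')]. *)
    destruct (Z_le_gt_dec a 0) as [Ha|Ha], (Z_le_gt_dec b 0) as [Hb|Hb].
    - assert (a * q <= 0)%Z by nia. assert (b * q' <= 0)%Z by nia. lia.
    - assert (1 <= IZR b) by (apply IZR_le; lia). assert (IZR a <= 0) by (apply IZR_le; auto). nra.
    - assert (1 <= IZR a) by (apply IZR_le; lia). assert (IZR b <= 0) by (apply IZR_le; auto). nra.
    - assert (q <= a * q)%Z by nia. assert (q' <= b * q')%Z by nia. lia. }
  exists i, (Z.to_nat q). repeat split; try lia.
  intros m Hm1 Hm2.
  (* Sites [m] and [m + 1] both avoid [[0, d)], since [2 q + 1 < q + q']. For [m] this means that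
     the shift by [q] sites subtracts [d] without wrapping around. *)
  pose proof (Hret (m - i)%nat ltac:(lia) ltac:(lia)) as R0.
  pose proof (Hret (S m - i)%nat ltac:(lia) ltac:(lia)) as R1.
  replace (i + (m - i))%nat with m in R0 by lia.
  replace (i + (S m - i))%nat with (S m) in R1 by lia.
  destruct (frac_shift (INR m * / phi + om)) as (z & Ez & Hz).
  assert (Eq : frac (INR (m + Z.to_nat q) * / phi + om) = frac (INR m * / phi + om) - d).
  { rewrite Ez. rewrite plus_INR, (INR_IZR_INZ (Z.to_nat q)), Z2Nat.id by lia.
    rewrite (frac_unique _ (z + p)); rewrite plus_IZR; lra. }
  unfold Vfib. rewrite Eq. set (x := frac (INR m * / phi + om)) in *.
  (* A point within [d] above the jump at [1 - / phi] would have its successor in [[0, d)], so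
     subtracting [d] does not cross this jump. *)
  assert (R2 : ~ (1 - / phi <= x < 1 - / phi + d)).
  { intros Hx. apply R1. rewrite S_INR.
    rewrite (frac_unique _ (z + 1)); rewrite plus_IZR; lra. }
  repeat destruct (Rle_dec _ _); repeat destruct (Rlt_dec _ _); lra.
Qed.

(** For [alpha < 0] and [t >= 2] the power [Rpower (t / 2) alpha] is at most [1], so [exp (mu * v)]
    absorbs the time dependence. The resulting uniform localization is refuted by the cubes. *)
Lemma LR_exponent_nonneg lam om alpha : 0 < lam -> LR lam om alpha -> 0 <= alpha.
Proof.
  intros Hl HLR. apply Rnot_lt_le. intros Ha.
  destruct (LR_one_particle _ _ _ HLR) as (C & mu & v & HC & Hmu & Hv & Hwave).
  apply (cubes_delocalize (Vfib lam om) (C * exp (mu * v)) mu); auto.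
  - intros n. apply Jacobi.exists_eigenbasis.
  - apply Vfib_cubes.
  - intros n E psi j m t basis Hjm Hm Ht.
    pose proof (Hwave n E psi j m (t / 2) basis Hjm Hm ltac:(lra)) as H.
    replace (2 * (t / 2)) with t in H by field.
    eapply Rle_trans; [exact H|]. rewrite Rmult_assoc, <- exp_plus.
    apply Rmult_le_compat_l; [lra|].
    assert (P : Rpower (t / 2) alpha <= 1).
    { rewrite <- (Rpower_O (t / 2)) by lra. apply Rle_Rpower; lra. }
    assert (Q : - mu * (INR (m - j) - v * Rpower (t / 2) alpha) <= mu * v + - mu * INR (m - j)).
    { assert (mu * v * Rpower (t / 2) alpha <= mu * v * 1)
        by (apply Rmult_le_compat_l; auto; apply Rmult_le_pos; lra). lra. }
    destruct Q as [Q|Q]; [left; apply exp_increasing; auto|rewrite Q; lra].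
Qed.

(** alpha >= alpha_u^+(lambda) = sup {beta >= 0 : S^+(beta) < oo},
    stated as: alpha is an upper bound of that set. *)
Theorem theorem2p6 (lam om alpha : R) :
  0 < lam -> 0 <= om < 1 ->
  LR lam om alpha ->
  forall beta : R, 0 <= beta -> Splus_finite lam om beta -> beta <= alpha.
Proof.
  intros Hl _ HLR beta Hb HS. destruct Hb as [Hb|<-].
  - apply (no_transport_beyond lam om); auto. intros n. apply Jacobi.exists_eigenbasis.
  - apply (LR_exponent_nonneg lam om); auto.
Qed.
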